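(* Over $\mathbf{CZF}_0$, each of the following statements is equivalent to the Law of Restricted Weak Excluded Middle ($\mathrm{RWEM}$): (1) The set $2=\{0,1\}$ is injective. (2) For every natural number $n\geq 2$, every disjoint union of $n$ injective sets is injective. (3) Every finite set of cardinality $\geq 2$ is injective. (4) There is a discrete injective set $E$ with at least $2$ elements (i.e. there are $x_0,x_1\in E$ with $x_0\neq x_1$).
   Context: $\mathbf{CZF}_0$ is the theory in intuitionistic first-order logic with equality, in the language of set theory ($\in$, $=$), with the axioms: extensionality; pairing; union; replacement (for arbitrary formulas); restricted separation (separation for $\Delta_0$-formulas only, i.e. formulas in which all quantifiers are bounded, of the form $\exists x\in y$ or $\forall x\in y$); strong infinity (there is a least inductive set $\mathbb{N}$); mathematical induction on $\mathbb{N}$ for arbitrary formulas. There is no power set axiom and no excluded middle. Here $0=\emptyset$, $1=\{0\}$, $2=\{0,1\}$, etc. Maps between sets are sets. A set $E$ is injective if every map with codomain $E$ can be extended to any superset of its domain: for all sets $X\subseteq Y$ and every map $f:X\to E$ there is a map $g:Y\to E$ with $g|_X=f$. A set $E$ is discrete if $\forall u,v\in E\,(u=v\vee u\neq v)$. A set is finite of cardinality $n\in\mathbb{N}$ if it is in bijection with $n=\{0,\dots,n-1\}$. A formula is restricted if it is $\Delta_0$ (parameters allowed). $\mathrm{RWEM}$ is the statement that $\lnot\varphi\vee\lnot\lnot\varphi$ holds for every restricted formula $\varphi$. (With $p_\varphi=\{x\in 1:\varphi\}$, one has $\varphi\leftrightarrow 0\in p_\varphi$, so $\mathrm{RWEM}$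 may be expressed as the single sentence: for every $p\subseteq 1$, $0\notin p$ or $\lnot(0\notin p)$.) *)

(* Defs.v *)
From Stdlib Require Import List.
Import ListNotations.

(** The only terms are variables, given by de Bruijn indices: [All] and [Ex]
    bind index [0], and index [k] of the ambient context becomes [S k] under
    one quantifier. *)
Inductive form : Type :=
| Bot : form
| Mem : nat -> nat -> form
| Eq  : nat -> nat -> form
| And : form -> form -> form
| Or  : form -> form -> form
| Imp : form -> form -> form
| All : form -> form
| Ex  : form -> form.

Declare Scope form_scope.
Delimit Scope form_scope with form.
Bind Scope form_scope with form.

Notation "x ∈ y" := (Mem x y) (at level 70, no associativity) : form_scope.
Notation "x ≐ y" := (Eq x y) (at level 70, no associativity) : form_scope.
Notation "A ⋏ B" := (And A B) (at level 80, right associativity) : form_scope.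
Notation "A ⋎ B" := (Or A B) (at level 85, right associativity) : form_scope.
Notation "A ⟶ B" := (Imp A B) (at level 90, right associativity) : form_scope.
Notation "¬ A" := (Imp A Bot) (at level 75, right associativity) : form_scope.
Notation "A ⟷ B" := (And (Imp A B) (Imp B A))
  (at level 95, no associativity) : form_scope.
Local Open Scope form_scope.

Definition up (r : nat -> nat) (n : nat) : nat :=
  match n with 0 => 0 | S k => S (r k) end.

Fixpoint ren (r : nat -> nat) (A : form) : form :=
  match A with
  | Bot => Bot
  | Mem x y => Mem (r x) (r y)
  | Eq x y => Eq (r x) (r y)
  | And B C => And (ren r B) (ren r C)
  | Or B C => Or (ren r B) (ren r C)
  | Imp B C => Imp (ren r B) (ren r C)
  | All B => All (ren (up r) B)
  | Ex B => Ex (ren (up r) B)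
  end.

Definition inst (t n : nat) : nat := match n with 0 => t | S k => k end.

Definition subst0 (A : form) (t : nat) : form := ren (inst t) A.

(** Natural deduction from the axioms [T] and the hypotheses [G].  Open members
    of [T] stand for their universal closures: [prf_AllI] imposes the
    eigenvariable condition on [G] only. *)
Inductive prf (T : form -> Prop) : list form -> form -> Prop :=
| prf_Ax G A : T A -> prf T G A
| prf_Hyp G A : In A G -> prf T G A
| prf_BotE G A : prf T G Bot -> prf T G A
| prf_AndI G A B : prf T G A -> prf T G B -> prf T G (A ⋏ B)
| prf_AndE1 G A B : prf T G (A ⋏ B) -> prf T G A
| prf_AndE2 G A B : prf T G (A ⋏ B) -> prf T G B
| prf_OrI1 G A B : prf T G A -> prf T G (A ⋎ B)
| prf_OrI2 G A B : prf T G B -> prf T G (A ⋎ B)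
| prf_OrE G A B C :
    prf T G (A ⋎ B) -> prf T (A :: G) C -> prf T (B :: G) C -> prf T G C
| prf_ImpI G A B : prf T (A :: G) B -> prf T G (A ⟶ B)
| prf_ImpE G A B : prf T G (A ⟶ B) -> prf T G A -> prf T G B
| prf_AllI G A : prf T (map (ren S) G) A -> prf T G (All A)
| prf_AllE G A t : prf T G (All A) -> prf T G (subst0 A t)
| prf_ExI G A t : prf T G (subst0 A t) -> prf T G (Ex A)
| prf_ExE G A B :
    prf T G (Ex A) -> prf T (A :: map (ren S) G) (ren S B) -> prf T G B
| prf_EqI G x : prf T G (x ≐ x)
| prf_EqE G A x y :
    prf T G (x ≐ y) -> prf T G (subst0 A x) -> prf T G (subst0 A y).

Definition provable (T : form -> Prop) (A : form) : Prop := prf T [] A.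

Definition extend (T U : form -> Prop) (A : form) : Prop := T A \/ U A.

Definition equivalent_over (T U V : form -> Prop) : Prop :=
  (forall A, V A -> provable (extend T U) A) /\
  (forall A, U A -> provable (extend T V) A).

(** Numeric arguments of the abbreviations below are variables of the ambient
    context; below [k] quantifiers the ambient variable [x] is written [k + x]. *)

Definition AllIn (x : nat) (A : form) : form := All (0 ∈ S x ⟶ A).
Definition ExIn (x : nat) (A : form) : form := Ex (0 ∈ S x ⋏ A).

(** [ren (up S) A] inserts a fresh variable at index [1]. *)
Definition ExUnique (A : form) : form :=
  Ex (A ⋏ All (ren (up S) A ⟶ 0 ≐ 1)).

Inductive restricted : form -> Prop :=
| restricted_Bot : restricted Bot
| restricted_Mem x y : restricted (x ∈ y)
| restricted_Eq x y : restricted (x ≐ y)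
| restricted_And A B : restricted A -> restricted B -> restricted (A ⋏ B)
| restricted_Or A B : restricted A -> restricted B -> restricted (A ⋎ B)
| restricted_Imp A B : restricted A -> restricted B -> restricted (A ⟶ B)
| restricted_AllIn x A : restricted A -> restricted (AllIn x A)
| restricted_ExIn x A : restricted A -> restricted (ExIn x A).

Definition Subset (x y : nat) : form := AllIn x (0 ∈ S y).

Definition IsEmpty (x : nat) : form := All (¬ 0 ∈ S x).
Definition IsOne (x : nat) : form := All (0 ∈ S x ⟷ IsEmpty 0).
Definition IsTwo (x : nat) : form := All (0 ∈ S x ⟷ IsEmpty 0 ⋎ IsOne 0).

(** [y = x ∪ {x}] *)
Definition IsSucc (x y : nat) : form := All (0 ∈ S y ⟷ 0 ∈ S x ⋎ 0 ≐ S x).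

Definition IsInductive (x : nat) : form :=
  ExIn x (IsEmpty 0) ⋏ AllIn x (ExIn (1 + x) (IsSucc 1 0)).

(** [x] is the least inductive set [ℕ]. *)
Definition IsNat (x : nat) : form :=
  IsInductive x ⋏ All (IsInductive 0 ⟶ Subset (1 + x) 0).

(** [z = {x, y}] *)
Definition IsPair (x y z : nat) : form := All (0 ∈ S z ⟷ 0 ≐ S x ⋎ 0 ≐ S y).

(** [z = ⟨x, y⟩ = {{x}, {x, y}}] *)
Definition IsOPair (x y z : nat) : form :=
  All (0 ∈ S z ⟷ IsPair (S x) (S x) 0 ⋎ IsPair (S x) (S y) 0).

(** [⟨x, y⟩ ∈ f] *)
Definition Rel (f x y : nat) : form := ExIn f (IsOPair (S x) (S y) 0).

(** [f : X → E] *)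
Definition IsMap (f X E : nat) : form :=
  AllIn f (ExIn (1 + X) (ExIn (2 + E) (IsOPair 1 0 2))) ⋏
  AllIn X (ExUnique (Rel (2 + f) 1 0)).

Definition IsBijection (f X Y : nat) : form :=
  IsMap f X Y ⋏ AllIn Y (ExUnique (Rel (2 + f) 0 1)).

(** [f = g|_X] *)
Definition IsRestriction (g X f : nat) : form :=
  All (0 ∈ S f ⟷ 0 ∈ S g ⋏ ExIn (1 + X) (Ex (IsOPair 1 0 2))).

(** The bound variables are, from the outside in, [X], [Y], [f], [g]. *)
Definition IsInjective (E : nat) : form :=
  All (All (Subset 1 0 ⟶
    All (IsMap 0 2 (3 + E) ⟶
      Ex (IsMap 0 2 (4 + E) ⋏ IsRestriction 0 3 1)))).

Definition IsDiscrete (E : nat) : form :=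
  AllIn E (AllIn (1 + E) (1 ≐ 0 ⋎ ¬ 1 ≐ 0)).

(** [2 ≤ n], the strict order on [ℕ] being membership. *)
Definition TwoLe (n : nat) : form := Ex (IsTwo 0 ⋏ (0 ∈ S n ⋎ 0 ≐ S n)).

Definition HasCardinality (A n : nat) : form := Ex (IsBijection 0 (1 + A) (1 + n)).

(** [D = {⟨i, x⟩ : i ∈ n, x ∈ F(i)}]; in the right-hand side [z] has index [3],
    [i] index [2], [F(i)] index [1] and [x] index [0]. *)
Definition IsDisjointUnion (D n F : nat) : form :=
  All (0 ∈ S D ⟷
    ExIn (1 + n) (Ex (Ex (Rel (4 + F) 2 1 ⋏ 0 ∈ 1 ⋏ IsOPair 2 0 3)))).

Definition Extensionality : form := All (All (All (0 ∈ 2 ⟷ 0 ∈ 1) ⟶ 1 ≐ 0)).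

Definition Pairing : form := All (All (Ex (IsPair 2 1 0))).

Definition Union : form := All (Ex (All (0 ∈ 1 ⟷ ExIn 2 (1 ∈ 0)))).

(** [(∀x∈a ∃!y A(x, y)) → ∃b ∀y (y ∈ b ↔ ∃x∈a A(x, y))], where [y] and [x] are
    the variables [0] and [1] of [A]; on the right [x], [y], [b] have indices
    [0], [1], [2]. *)
Definition Replacement (a : nat) (A : form) : form :=
  AllIn a (ExUnique A) ⟶
  Ex (All (0 ∈ 1 ⟷
    ExIn (2 + a)
      (ren (fun k => match k with 0 => 1 | 1 => 0 | S (S k) => 3 + k end) A))).

(** [∃b ∀x (x ∈ b ↔ x ∈ a ∧ A(x))], where [x] is the variable [0] of [A]. *)
Definition Separation (a : nat) (A : form) : form :=
  Ex (All (0 ∈ 1 ⟷ 0 ∈ 2 + a ⋏ ren (up S) A)).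

Definition StrongInfinity : form := Ex (IsNat 0).

(** [A(0) ∧ ∀n∈N (A(n) → A(n+1)) → ∀n∈N A(n)], where [N] is [ℕ] and [n] is the
    variable [0] of [A]. *)
Definition Induction (N : nat) (A : form) : form :=
  IsNat N ⟶
  All (IsEmpty 0 ⟶ A) ⋏ AllIn N (A ⟶ All (IsSucc 1 0 ⟶ ren (up S) A)) ⟶
  AllIn N A.

Inductive CZF0 : form -> Prop :=
| Ax_ext : CZF0 Extensionality
| Ax_pair : CZF0 Pairing
| Ax_union : CZF0 Union
| Ax_repl a A : CZF0 (Replacement a A)
| Ax_sep a A : restricted A -> CZF0 (Separation a A)
| Ax_inf : CZF0 StrongInfinity
| Ax_ind N A : CZF0 (Induction N A).

Inductive RWEM : form -> Prop :=
| RWEM_intro A : restricted A -> RWEM (¬ A ⋎ ¬ ¬ A).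

Definition TwoInjective : form := All (IsTwo 0 ⟶ IsInjective 0).

(** The bound variables are [N], [n], then the codomain [C] of the family,
    the family [F : n → C], and its disjoint union [D]. *)
Definition DisjointUnionsInjective : form :=
  All (IsNat 0 ⟶ AllIn 0 (TwoLe 0 ⟶
    All (All (IsMap 0 2 1 ⟶
      AllIn 2 (All (Rel 2 1 0 ⟶ IsInjective 0)) ⟶
      All (IsDisjointUnion 0 3 1 ⟶ IsInjective 0))))).

Definition FiniteSetsInjective : form :=
  All (IsNat 0 ⟶ AllIn 0 (TwoLe 0 ⟶
    All (HasCardinality 0 1 ⟶ IsInjective 0))).

Definition DiscreteInjectiveExists : form :=
  Ex (IsDiscrete 0 ⋏ IsInjective 0 ⋏ ExIn 0 (ExIn 1 (¬ 1 ≐ 0))).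

(* Main.v *)
(** Let [φ] be restricted.  If [E] is discrete and injective with [x0 ≠ x1] in
    [E], map the subset [{z ∈ 1 : φ ∨ ¬φ}] of [1] to [E], sending [0] to [x1] if
    [φ] and to [x0] if [¬φ], and extend to [g : 1 → E].  Then [g(0) = x1] gives
    [¬¬φ], and [g(0) ≠ x1] gives [¬φ].

    Conversely, by RWEM the union of two disjoint injective sets [U] and [V] is
    injective: given [f : X → U ∪ V] and [X ⊆ Y], split [Y] along
    [¬ f(y) ∈ V] and [¬¬ f(y) ∈ V]; on [X] these say [f(y) ∈ U] and [f(y) ∈ V],
    so [f] extends on each part separately.  By induction on [m ≤ n], a set
    mapped to [n] with injective fibres is injective; finite sets (singleton
    fibres) and disjoint unions are the instances needed. *)

(* Equivalence over [CZF0] is derivability in an explicit calculus, so the arguments are carried out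
   inside [prf], over an arbitrary theory that contains [CZF0] and is closed under renaming. The
   same lemmas then serve [CZF0] with RWEM and [CZF0] with any one of the four statements. Statement
   (4) is the hub: each statement yields (4), (4) yields RWEM, and RWEM yields each statement.

   The obstacle in the union step is that [f] lives on X while a choice must be made at every point
   of Y. The condition that [f] relates y to some element of V makes sense on all of Y and is
   restricted up to provable equivalence. Only its negation gets decided, which suffices because U
   and V are disjoint.

   The empty set is not injective, since the empty map into it does not extend to 1. Hence the
   induction must set m = 0 apart, and [2 ≤ n] enters by making n inhabited. *)
From Stdlib Require Import List PeanoNat Lia.
Require Import Defs.
Import ListNotations.
Local Open Scope form_scope.

(** * Renamings and free variables *)

Lemma ren_ext A : forall r r', (forall k, r k = r' k) -> ren r A = ren r' A.
Proof.
  induction A; intros r r' E; cbn; f_equal; auto;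
    apply IHA; intros [|k]; cbn; auto.
Qed.

Lemma ren_ren A : forall r s, ren r (ren s A) = ren (fun k => r (s k)) A.
Proof.
  induction A; intros r s; cbn; f_equal; auto;
    rewrite IHA; apply ren_ext; intros [|k]; reflexivity.
Qed.

Lemma ren_id A : forall r, (forall k, r k = k) -> ren r A = A.
Proof.
  induction A; intros r E; cbn; f_equal; auto;
    apply IHA; intros [|k]; cbn; auto.
Qed.

Lemma ren_subst0 r A t : ren r (subst0 A t) = subst0 (ren (up r) A) (r t).
Proof.
  unfold subst0; rewrite !ren_ren; apply ren_ext; intros [|k]; reflexivity.
Qed.

Lemma ren_up_S r A : ren (up r) (ren S A) = ren S (ren r A).
Proof. rewrite !ren_ren; apply ren_ext; reflexivity. Qed.

(** The uniqueness clause of [ExUnique] inserts a dummy variable for the witness; instantiating that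
    variable with [s] cancels the insertion. *)
Lemma subst0_up_S A t s : subst0 (ren (up (inst s)) (ren (up S) A)) t = subst0 A t.
Proof.
  unfold subst0; rewrite !ren_ren; apply ren_ext; intros [|k]; reflexivity.
Qed.

Lemma restricted_ren A : restricted A -> forall r, restricted (ren r A).
Proof.
  induction 1; intros r; cbn; try constructor; auto.
Qed.

(** Expresses that all free variables lie below [n], through the action of renamings. *)
Definition determined (n : nat) (A : form) : Prop :=
  forall r r', (forall k, k < n -> r k = r' k) -> ren r A = ren r' A.

Lemma determined_le A n m : n <= m -> determined n A -> determined m A.
Proof. intros L H r r' E; apply H; intros; apply E; lia. Qed.

Lemma determined_ex A : exists n, determined n A.
Proof.
  induction A;
    try (destruct IHA1 as [a Ha], IHA2 as [b Hb]; exists (max a b);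
         intros r r' E; cbn; f_equal; [apply Ha | apply Hb]; intros; apply E; lia);
    try (destruct IHA as [a Ha]; exists a; intros r r' E; cbn; f_equal; apply Ha;
         intros [|k] L; cbn; auto; f_equal; apply E; lia).
  - exists 0; intros ? ? ?; reflexivity.
  - exists (S (max n n0)); intros r r' E; cbn; f_equal; apply E; lia.
  - exists (S (max n n0)); intros r r' E; cbn; f_equal; apply E; lia.
Qed.

Lemma determined_ex_list G : exists n, forall A, In A G -> determined n A.
Proof.
  induction G as [|A G [n Hn]].
  - exists 0; intros A [].
  - destruct (determined_ex A) as [m Hm]; exists (max n m); intros B [<-|I].
    + eapply determined_le; [|apply Hm]; lia.
    + eapply determined_le; [|apply Hn, I]; lia.
Qed.

(** Turns the named variable [n] back into the bound variable 0 and shifts all others. It undoes the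
    instantiation of a quantifier by a fresh [n]. *)
Definition unname (n k : nat) : nat := if k =? n then 0 else S k.

Lemma unname_determined n A : determined n A -> ren (unname n) A = ren S A.
Proof.
  intros H; apply H; intros k L; unfold unname.
  destruct (Nat.eqb_spec k n); [lia | reflexivity].
Qed.

Lemma unname_subst0 n A : determined n A -> ren (unname n) (subst0 A n) = A.
Proof.
  intros H; unfold subst0; rewrite ren_ren.
  transitivity (ren (fun k => k) A); [|apply ren_id; reflexivity].
  apply (determined_le _ n (S n)) in H; [|lia]; apply H.
  intros [|k] L; cbn; unfold unname.
  - now rewrite Nat.eqb_refl.
  - destruct (Nat.eqb_spec k n); [lia | reflexivity].
Qed.

Lemma unname_map n G :
  (forall A, In A G -> determined n A) -> map (ren (unname n)) G = map (ren S) G.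
Proof. intros H; apply map_ext_in; intros; apply unname_determined; auto. Qed.

(** * Deductions *)

(** Closure under renaming lets axioms be renamed along with the deduction that uses them, which
    [prf_ren] requires. *)
Record theory (T : form -> Prop) : Prop := {
  theory_ren : forall r A, T A -> T (ren r A);
  theory_CZF0 : forall A, CZF0 A -> T A
}.

Local Ltac form_congr :=
  repeat lazymatch goal with
  | |- ren _ _ = ren _ _ => fail
  | |- @eq form _ _ => progress f_equal
  end.

Lemma CZF0_ren r A : CZF0 A -> CZF0 (ren r A).
Proof.
  destruct 1; try (cbn; constructor; fail).
  - replace (ren r (Replacement a A)) with (Replacement (r a) (ren (up (up r)) A));
      [constructor|].
    unfold Replacement, AllIn, ExUnique, ExIn; cbn -[Nat.add].
    rewrite !ren_ren; form_congr; apply ren_ext; intros [|[|k]]; reflexivity.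
  - replace (ren r (Separation a A)) with (Separation (r a) (ren (up r) A));
      [constructor; now apply restricted_ren|].
    unfold Separation; cbn.
    rewrite !ren_ren; form_congr; apply ren_ext; intros [|[|k]]; reflexivity.
  - replace (ren r (Induction N A)) with (Induction (r N) (ren (up r) A));
      [constructor|].
    unfold Induction, AllIn; cbn.
    rewrite !ren_ren; form_congr; apply ren_ext; intros [|[|k]]; reflexivity.
Qed.

Lemma theory_extend U :
  (forall r A, U A -> U (ren r A)) -> theory (extend CZF0 U).
Proof.
  intros HU; split.
  - intros r A [H|H]; [left; now apply CZF0_ren | right; auto].
  - intros A H; now left.
Qed.

Lemma RWEM_ren r A : RWEM A -> RWEM (ren r A).
Proof.
  intros [B HB]; apply (RWEM_intro (ren r B)); now apply restricted_ren.
Qed.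

(** The context of a deduction plays the role of a Kripke world: the rules that
    discharge hypotheses or choose eigenvariables quantify over extensions of the
    context, so that hypotheses and variables of the object theory become
    hypotheses and variables of the metatheory. *)
Section Logic.

Context {T : form -> Prop} (HT : theory T).
Implicit Types (G : list form) (A B C : form).
Local Notation "G ⊢ A" := (prf T G A%form) (at level 98, A at level 97).

Lemma weaken G A : G ⊢ A -> forall G', incl G G' -> G' ⊢ A.
Proof.
  assert (ext : forall A G G', incl G G' -> incl (A :: G) (A :: G')).
  { intros B H H' I x [<-|J]; [now left | right; now apply I]. }
  assert (lift : forall G G', incl G G' -> incl (map (ren S) G) (map (ren S) G')).
  { intros H H' I; now apply incl_map. }
  induction 1; intros G' I.
  - now apply prf_Ax.
  - apply prf_Hyp; auto.
  - apply prf_BotE; auto.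
  - apply prf_AndI; auto.
  - eapply prf_AndE1; auto.
  - eapply prf_AndE2; auto.
  - apply prf_OrI1; auto.
  - apply prf_OrI2; auto.
  - eapply prf_OrE; auto.
  - apply prf_ImpI; auto.
  - eapply prf_ImpE; auto.
  - apply prf_AllI; auto.
  - apply prf_AllE; auto.
  - eapply prf_ExI; eauto.
  - eapply prf_ExE; eauto.
  - apply prf_EqI.
  - eapply prf_EqE; eauto.
Qed.

Lemma prf_ren G A : G ⊢ A -> forall r, map (ren r) G ⊢ ren r A.
Proof.
  assert (up_map : forall r G,
    map (ren (up r)) (map (ren S) G) = map (ren S) (map (ren r) G)).
  { intros r H; rewrite !map_map; apply map_ext; intros; apply ren_up_S. }
  induction 1; intros r; cbn in *.
  - apply prf_Ax; now apply (theory_ren _ HT).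
  - apply prf_Hyp; now apply in_map.
  - apply prf_BotE; apply IHprf.
  - apply prf_AndI; auto.
  - eapply prf_AndE1; apply IHprf.
  - eapply prf_AndE2; apply IHprf.
  - apply prf_OrI1; auto.
  - apply prf_OrI2; auto.
  - eapply prf_OrE; [apply IHprf1 | apply IHprf2 | apply IHprf3].
  - apply prf_ImpI; auto.
  - eapply prf_ImpE; [apply IHprf1 | apply IHprf2].
  - apply prf_AllI; rewrite <- up_map; auto.
  - rewrite ren_subst0; apply prf_AllE, IHprf.
  - eapply prf_ExI; rewrite <- ren_subst0; auto.
  - eapply prf_ExE; [apply IHprf1|].
    rewrite <- up_map, <- ren_up_S; apply (IHprf2 (up r)).
  - apply prf_EqI.
  - rewrite ren_subst0; eapply prf_EqE; [apply IHprf1|].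
    rewrite <- ren_subst0; auto.
Qed.

Lemma imp_intro G A B :
  (forall G', incl G G' -> G' ⊢ A -> G' ⊢ B) -> G ⊢ A ⟶ B.
Proof.
  intros H; apply prf_ImpI, H; [apply incl_tl, incl_refl | apply prf_Hyp; now left].
Qed.

Lemma or_elim G A B C :
  G ⊢ A ⋎ B ->
  (forall G', incl G G' -> G' ⊢ A -> G' ⊢ C) ->
  (forall G', incl G G' -> G' ⊢ B -> G' ⊢ C) -> G ⊢ C.
Proof.
  intros H HA HB; eapply prf_OrE; [exact H | apply HA | apply HB];
    try (apply incl_tl, incl_refl); apply prf_Hyp; now left.
Qed.

(** The premise covers every variable, so it may be used at an [n] fresh for [G] and [A]. Renaming
    that deduction by [unname n] turns it into one about the eigenvariable 0. *)
Lemma all_intro G A : (forall n, G ⊢ subst0 A n) -> G ⊢ All A.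
Proof.
  intros H.
  destruct (determined_ex_list (A :: G)) as [n Hn].
  apply prf_AllI.
  rewrite <- (unname_map n), <- (unname_subst0 n A) by (intros; apply Hn; cbn; auto).
  apply prf_ren, H.
Qed.

Lemma ex_elim G A C :
  G ⊢ Ex A ->
  (forall G', incl G G' -> forall n, G' ⊢ subst0 A n -> G' ⊢ C) -> G ⊢ C.
Proof.
  intros HE H.
  destruct (determined_ex_list (A :: C :: G)) as [n Hn].
  eapply prf_ExE; [exact HE|].
  rewrite <- (unname_map n) by (intros; apply Hn; cbn; auto).
  rewrite <- (unname_subst0 n A), <- (unname_determined n C)
    by (intros; apply Hn; cbn; auto).
  apply (prf_ren (subst0 A n :: G)).
  apply (H _ (incl_tl _ (incl_refl _)) n), prf_Hyp; now left.
Qed.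

Lemma and_split G A B : G ⊢ A ⋏ B -> (G ⊢ A) /\ (G ⊢ B).
Proof. intros H; split; [eapply prf_AndE1 | eapply prf_AndE2]; exact H. Qed.

Lemma iff_fwd G A B : G ⊢ A ⟷ B -> G ⊢ A -> G ⊢ B.
Proof. intros H HA; eapply prf_ImpE; [eapply prf_AndE1, H | exact HA]. Qed.

Lemma iff_bwd G A B : G ⊢ A ⟷ B -> G ⊢ B -> G ⊢ A.
Proof. intros H HA; eapply prf_ImpE; [eapply prf_AndE2, H | exact HA]. Qed.

Lemma allin_intro G x A :
  (forall G', incl G G' -> forall z, G' ⊢ z ∈ x -> G' ⊢ subst0 A z) -> G ⊢ AllIn x A.
Proof.
  intros H; apply all_intro; intros z; apply imp_intro; intros G' I Hz.
  exact (H G' I z Hz).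
Qed.

Lemma allin_elim G x A z : G ⊢ AllIn x A -> G ⊢ z ∈ x -> G ⊢ subst0 A z.
Proof. intros H Hz; exact (prf_ImpE _ _ _ _ (prf_AllE _ _ _ z H) Hz). Qed.

Lemma exin_intro G x A z : G ⊢ z ∈ x -> G ⊢ subst0 A z -> G ⊢ ExIn x A.
Proof. intros Hz H; apply (prf_ExI _ _ _ z); exact (prf_AndI _ _ _ _ Hz H). Qed.

Lemma exin_elim G x A C :
  G ⊢ ExIn x A ->
  (forall G', incl G G' -> forall z, G' ⊢ z ∈ x -> G' ⊢ subst0 A z -> G' ⊢ C) -> G ⊢ C.
Proof.
  intros HE H; apply (ex_elim _ _ _ HE); intros G' I z Hz.
  apply and_split in Hz as [Hz HA]; exact (H G' I z Hz HA).
Qed.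

Lemma exu_intro G A t :
  G ⊢ subst0 A t ->
  (forall G', incl G G' -> forall z, G' ⊢ subst0 A z -> G' ⊢ z ≐ t) -> G ⊢ ExUnique A.
Proof.
  intros H HU; apply (prf_ExI _ _ _ t), prf_AndI; [exact H|].
  apply all_intro; intros z; apply imp_intro; intros G' I Hz.
  apply (HU G' I z); rewrite <- (subst0_up_S A z t); exact Hz.
Qed.

Lemma exu_elim G A C :
  G ⊢ ExUnique A ->
  (forall G', incl G G' -> forall z, G' ⊢ subst0 A z -> G' ⊢ C) -> G ⊢ C.
Proof.
  intros HE H; apply (ex_elim _ _ _ HE); intros G' I z Hz.
  apply and_split in Hz as [Hz _]; exact (H G' I z Hz).
Qed.

Lemma eq_sym G x y : G ⊢ x ≐ y -> G ⊢ y ≐ x.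
Proof. intros H; apply (prf_EqE _ _ (0 ≐ S x) x y H), prf_EqI. Qed.

Lemma eq_trans G x y z : G ⊢ x ≐ y -> G ⊢ y ≐ z -> G ⊢ x ≐ z.
Proof. intros H H'; exact (prf_EqE _ _ (S x ≐ 0) y z H' H). Qed.

Lemma exu_uniq G A x y :
  G ⊢ ExUnique A -> G ⊢ subst0 A x -> G ⊢ subst0 A y -> G ⊢ x ≐ y.
Proof.
  intros HE Hx Hy; apply (ex_elim _ _ _ HE); intros G' I z Hz.
  apply and_split in Hz as [_ Hz].
  apply (weaken _ _) with (G' := G') in Hx, Hy; auto.
  rewrite <- (subst0_up_S A x z) in Hx; rewrite <- (subst0_up_S A y z) in Hy.
  apply eq_trans with z; [|apply eq_sym].
  - exact (prf_ImpE _ _ _ _ (prf_AllE _ _ _ x Hz) Hx).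
  - exact (prf_ImpE _ _ _ _ (prf_AllE _ _ _ y Hz) Hy).
Qed.


(** * Renaming through the defined predicates, and tactics for object-level deductions *)

Lemma ren_Subset r x y : ren r (Subset x y) = Subset (r x) (r y).
Proof. reflexivity. Qed.
Lemma ren_IsEmpty r x : ren r (IsEmpty x) = IsEmpty (r x).
Proof. reflexivity. Qed.
Lemma ren_IsOne r x : ren r (IsOne x) = IsOne (r x).
Proof. reflexivity. Qed.
Lemma ren_IsTwo r x : ren r (IsTwo x) = IsTwo (r x).
Proof. reflexivity. Qed.
Lemma ren_IsSucc r x y : ren r (IsSucc x y) = IsSucc (r x) (r y).
Proof. reflexivity. Qed.
Lemma ren_IsInductive r x : ren r (IsInductive x) = IsInductive (r x).
Proof. reflexivity. Qed.
Lemma ren_IsNat r x : ren r (IsNat x) = IsNat (r x).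
Proof. reflexivity. Qed.
Lemma ren_IsPair r x y z : ren r (IsPair x y z) = IsPair (r x) (r y) (r z).
Proof. reflexivity. Qed.
Lemma ren_IsOPair r x y z : ren r (IsOPair x y z) = IsOPair (r x) (r y) (r z).
Proof. reflexivity. Qed.
Lemma ren_Rel r f x y : ren r (Rel f x y) = Rel (r f) (r x) (r y).
Proof. reflexivity. Qed.
Lemma ren_IsMap r f X E : ren r (IsMap f X E) = IsMap (r f) (r X) (r E).
Proof. reflexivity. Qed.
Lemma ren_IsBijection r f X Y : ren r (IsBijection f X Y) = IsBijection (r f) (r X) (r Y).
Proof. reflexivity. Qed.
Lemma ren_IsRestriction r g X f : ren r (IsRestriction g X f) = IsRestriction (r g) (r X) (r f).
Proof. reflexivity. Qed.
Lemma ren_IsInjective r E : ren r (IsInjective E) = IsInjective (r E).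
Proof. reflexivity. Qed.
Lemma ren_IsDiscrete r E : ren r (IsDiscrete E) = IsDiscrete (r E).
Proof. reflexivity. Qed.
Lemma ren_TwoLe r n : ren r (TwoLe n) = TwoLe (r n).
Proof. reflexivity. Qed.
Lemma ren_HasCardinality r x n : ren r (HasCardinality x n) = HasCardinality (r x) (r n).
Proof. reflexivity. Qed.
Lemma ren_IsDisjointUnion r D n F :
  ren r (IsDisjointUnion D n F) = IsDisjointUnion (r D) (r n) (r F).
Proof. reflexivity. Qed.
Lemma ren_AllIn r x A : ren r (AllIn x A) = AllIn (r x) (ren (up r) A).
Proof. reflexivity. Qed.
Lemma ren_ExIn r x A : ren r (ExIn x A) = ExIn (r x) (ren (up r) A).
Proof. reflexivity. Qed.
(** Unlike its neighbours this is not a mere conversion, because the body of [ExUnique] already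
    contains a renaming of [A]. *)
Lemma ren_ExUnique r A : ren r (ExUnique A) = ExUnique (ren (up r) A).
Proof.
  unfold ExUnique; cbn; rewrite !ren_ren.
  do 4 f_equal; apply ren_ext; intros [|k]; reflexivity.
Qed.

Hint Rewrite ren_Subset ren_IsEmpty ren_IsOne ren_IsTwo ren_IsSucc ren_IsInductive
  ren_IsNat ren_IsPair ren_IsOPair ren_Rel ren_IsMap ren_IsBijection ren_IsRestriction
  ren_IsInjective ren_IsDiscrete ren_TwoLe ren_HasCardinality ren_IsDisjointUnion
  ren_AllIn ren_ExIn ren_ExUnique : ren_pred.

(** The order follows two nested quantifiers: [x] replaces variable 1, the outer one, and [y]
    replaces variable 0. *)
Definition subst1 A (x y : nat) : form := subst0 (ren (up (inst x)) A) y.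

Ltac simp_form :=
  unfold subst1, subst0;
  repeat first [progress cbn [ren up inst Nat.add] | progress autorewrite with ren_pred].
Ltac simp_form_in H :=
  unfold subst1, subst0 in H;
  repeat first [progress cbn [ren up inst Nat.add] in H | progress autorewrite with ren_pred in H].

(** Moves every hypothesis to the extended context [G'] and renames it [G]. *)
Ltac weaken_all L :=
  lazymatch type of L with incl ?G ?G' =>
    repeat match goal with
    | h : prf _ G _ |- _ =>
        let h' := fresh in pose proof (weaken _ _ h _ L) as h'; clear h; rename h' into h
    | h : forall x, prf ?T G (@?P x) |- _ =>
        let h' := fresh in
        assert (h' : forall x, prf T G' (P x)) by (intro; apply (weaken _ _ (h _) _ L));
        clear h; rename h' into h
    | h : forall x y, prf ?T G (@?P x y) |- _ =>
        let h' := fresh in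
        assert (h' : forall x y, prf T G' (P x y)) by (intros; apply (weaken _ _ (h _ _) _ L));
        clear h; rename h' into h
    | h : forall x y z, prf ?T G (@?P x y z) |- _ =>
        let h' := fresh in
        assert (h' : forall x y z, prf T G' (P x y z))
          by (intros; apply (weaken _ _ (h _ _ _) _ L));
        clear h; rename h' into h
    | h : forall x y z w, prf ?T G (@?P x y z w) |- _ =>
        let h' := fresh in
        assert (h' : forall x y z w, prf T G' (P x y z w))
          by (intros; apply (weaken _ _ (h _ _ _ _) _ L));
        clear h; rename h' into h
    end;
    cbn beta in *; clear L; clear G; rename G' into G
  end.
Ltac step := let G' := fresh "G" in let L := fresh in intros G' L; weaken_all L.

Tactic Notation "iintro" ident(h) :=
  try match goal with
      | |- prf ?T ?G ?F => let F' := eval hnf in F in change (prf T G F')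
      end;
  lazymatch goal with
  | |- prf _ _ (Imp _ _) => apply imp_intro; step; intros h
  | |- prf _ _ (All _) => apply all_intro; intros h; simp_form
  end.
Tactic Notation "iintroin" ident(z) ident(h) :=
  apply allin_intro; step; intros z h; simp_form.
Tactic Notation "iiff" ident(h) := apply prf_AndI; iintro h.
Ltac consume H p := pose proof H as p; try (is_var H; clear H).
Tactic Notation "iex" constr(H) "as" ident(x) ident(h) :=
  let p := fresh in consume H p; apply (ex_elim _ _ _ p);
  step; clear p; intros x h; simp_form_in h.
Tactic Notation "iexin" constr(H) "as" ident(x) ident(hx) ident(h) :=
  let p := fresh in consume H p; apply (exin_elim _ _ _ _ p);
  step; clear p; intros x hx h; simp_form_in hx; simp_form_in h.
Tactic Notation "iexu" constr(H) "as" ident(x) ident(h) :=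
  let p := fresh in pose proof H as p; apply (exu_elim _ _ _ p);
  step; clear p; intros x h; simp_form_in h.
Tactic Notation "ior" constr(H) "as" ident(h) :=
  let p := fresh in consume H p; apply (or_elim _ _ _ _ p); step; clear p; intros h.
Tactic Notation "iand" hyp(H) "as" simple_intropattern(h) :=
  apply and_split in H; destruct H as h.
Tactic Notation "iexists" constr(t) := apply (prf_ExI _ _ _ t); simp_form.
Ltac isplit := apply prf_AndI.
Ltac ileft := apply prf_OrI1.
Ltac iright := apply prf_OrI2.
Ltac iabsurd := apply prf_BotE.

(** [shift_vars F d] is [F] with each variable not listed in [d] replaced by its
    successor, i.e. with a new variable [0]. *)
Ltac shift_vars F d :=
  match goal with
  | z : nat |- _ =>
    let _ := match F with context [z] => constr:(tt) end in
    let _ := match goal with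
             | _ => let _ := match d with context [z] => constr:(tt) end in fail 1
             | _ => constr:(tt) end in
    let P := eval pattern z in F in
    match P with ?f _ =>
      let F' := eval cbv beta in (f (S z)) in shift_vars F' (d, z)
    end
  | _ => F
  end.
(* [prf_EqE] expects a template with the rewritten variable at index 0. The tactic abstracts the
   occurrences of [y] from the goal and shifts the remaining variables to obtain it. *)
Tactic Notation "irewrite" "<-" constr(H) :=
  lazymatch type of H with
  | prf _ _ (Eq ?x ?y) =>
    lazymatch goal with
    | |- prf ?T ?G ?F =>
      let P := eval pattern y in F in
      lazymatch P with
      | ?f _ =>
        let z := fresh in
        let Q := constr:(fun z : nat => ltac:(
          let F0 := eval cbv beta in (f z) in
          let F1 := shift_vars F0 (tt, z) in exact F1)) in
        let B := eval cbv beta in (Q 0) in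
        refine (prf_EqE _ _ B x y H _); simp_form
      end
    end
  end.
Tactic Notation "irewrite" "->" constr(H) :=
  let h := fresh in pose proof (eq_sym _ _ _ H) as h; irewrite <- h; clear h.

(** * Pairs and maps *)

Lemma extensionality G x y : (forall z, G ⊢ z ∈ x ⟷ z ∈ y) -> G ⊢ x ≐ y.
Proof.
  intros H.
  assert (E : G ⊢ Extensionality) by (apply prf_Ax, (theory_CZF0 _ HT), Ax_ext).
  pose proof (prf_AllE _ _ _ y (prf_AllE _ _ _ x E)) as E'.
  refine (prf_ImpE _ _ _ _ E' _); apply all_intro; exact H.
Qed.

Lemma mem_eq_l G x y z : G ⊢ x ≐ y -> G ⊢ x ∈ z -> G ⊢ y ∈ z.
Proof. intros H H'; irewrite <- H; exact H'. Qed.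

Lemma mem_eq_r G x y z : G ⊢ x ≐ y -> G ⊢ z ∈ x -> G ⊢ z ∈ y.
Proof. intros H H'; irewrite <- H; exact H'. Qed.

Lemma pair_ex G x y : G ⊢ Ex (IsPair (S x) (S y) 0).
Proof.
  assert (E : G ⊢ Pairing) by (apply prf_Ax, (theory_CZF0 _ HT), Ax_pair).
  exact (prf_AllE _ _ _ y (prf_AllE _ _ _ x E)).
Qed.

Lemma pair_mem G x y z w : G ⊢ IsPair x y z -> G ⊢ w ∈ z ⟷ w ≐ x ⋎ w ≐ y.
Proof. intros H; exact (prf_AllE _ _ _ w H). Qed.

Lemma pair_mem_l G x y z : G ⊢ IsPair x y z -> G ⊢ x ∈ z.
Proof. intros H; apply (iff_bwd _ _ _ (pair_mem _ _ _ _ x H)); ileft; apply prf_EqI. Qed.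

Lemma pair_mem_r G x y z : G ⊢ IsPair x y z -> G ⊢ y ∈ z.
Proof. intros H; apply (iff_bwd _ _ _ (pair_mem _ _ _ _ y H)); iright; apply prf_EqI. Qed.

Lemma iff_sym G A B : G ⊢ A ⟷ B -> G ⊢ B ⟷ A.
Proof. intros H; iand H as [H H']; isplit; assumption. Qed.

Lemma iff_trans G A B C : G ⊢ A ⟷ B -> G ⊢ B ⟷ C -> G ⊢ A ⟷ C.
Proof.
  intros H H'; iiff h.
  - exact (iff_fwd _ _ _ H' (iff_fwd _ _ _ H h)).
  - exact (iff_bwd _ _ _ H (iff_bwd _ _ _ H' h)).
Qed.

Lemma pair_eq G x y z z' : G ⊢ IsPair x y z -> G ⊢ IsPair x y z' -> G ⊢ z ≐ z'.
Proof.
  intros H H'; apply extensionality; intros w.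
  apply iff_trans with (w ≐ x ⋎ w ≐ y); [|apply iff_sym]; now apply pair_mem.
Qed.

Lemma opair_mem G x y z w :
  G ⊢ IsOPair x y z -> G ⊢ w ∈ z ⟷ IsPair x x w ⋎ IsPair x y w.
Proof. intros H; exact (prf_AllE _ _ _ w H). Qed.

Lemma opair_ex G x y : G ⊢ Ex (IsOPair (S x) (S y) 0).
Proof.
  iex (pair_ex G x x) as s Hs. iex (pair_ex G x y) as p Hp.
  iex (pair_ex G s p) as z Hz. iexists z.
  unfold IsOPair. iintro w. iiff h.
  - ior (iff_fwd _ _ _ (pair_mem _ _ _ _ w Hz) h) as e.
    + ileft. irewrite -> e. exact Hs.
    + iright. irewrite -> e. exact Hp.
  - apply (iff_bwd _ _ _ (pair_mem _ _ _ _ w Hz)). ior h as e.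
    + ileft. exact (pair_eq _ _ _ _ _ e Hs).
    + iright. exact (pair_eq _ _ _ _ _ e Hp).
Qed.

Lemma opair_eq G x y z z' : G ⊢ IsOPair x y z -> G ⊢ IsOPair x y z' -> G ⊢ z ≐ z'.
Proof.
  intros H H'; apply extensionality; intros w.
  apply iff_trans with (IsPair x x w ⋎ IsPair x y w); [|apply iff_sym];
    now apply opair_mem.
Qed.

(** The singleton {x} is an element of z, hence equals {x'} or {x', y'}. Both contain x', so x' lies
    in {x}. *)
Lemma opair_inj_l G x y x' y' z :
  G ⊢ IsOPair x y z -> G ⊢ IsOPair x' y' z -> G ⊢ x ≐ x'.
Proof.
  intros H H'. iex (pair_ex G x x) as s Hs.
  assert (h : G ⊢ s ∈ z) by (apply (iff_bwd _ _ _ (opair_mem _ _ _ _ s H)); ileft; exact Hs).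
  assert (h' : G ⊢ x' ∈ s).
  { ior (iff_fwd _ _ _ (opair_mem _ _ _ _ s H') h) as e; exact (pair_mem_l _ _ _ _ e). }
  apply eq_sym. ior (iff_fwd _ _ _ (pair_mem _ _ _ _ x' Hs) h') as e; exact e.
Qed.

(** Equality need not be decidable, so the cases come from membership: {x, y} is {x} or {x, y'}. In
    the first case y = x, all elements of z collapse to {x}, and y' = x follows. In the second, y is
    x or y'; if y = x, then y' in {x, y} settles it. *)
Lemma opair_inj_r G x y x' y' z :
  G ⊢ IsOPair x y z -> G ⊢ IsOPair x' y' z -> G ⊢ y ≐ y'.
Proof.
  intros H H'.
  assert (E : G ⊢ x' ≐ x) by (apply eq_sym; exact (opair_inj_l _ _ _ _ _ _ H H')).
  assert (H0 : G ⊢ IsOPair x y' z) by (irewrite <- E; exact H').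
  clear H' E x'.
  iex (pair_ex G x y) as p Hp. iex (pair_ex G x y') as p' Hp'.
  assert (h : G ⊢ p ∈ z) by (apply (iff_bwd _ _ _ (opair_mem _ _ _ _ p H)); iright; exact Hp).
  assert (h' : G ⊢ p' ∈ z) by (apply (iff_bwd _ _ _ (opair_mem _ _ _ _ p' H0)); iright; exact Hp').
  assert (single : forall u v, G ⊢ u ≐ x ⟶ (IsPair x x v ⋎ IsPair x u v) ⟶ (IsPair x x v)).
  { intros u v. iintro e. iintro k. ior k as k; [exact k|].
    refine (prf_EqE _ _ (IsPair (S x) 0 (S v)) u x e _). exact k. }
  ior (iff_fwd _ _ _ (opair_mem _ _ _ _ p H0) h) as e.
  - assert (e1 : G ⊢ y ≐ x)
      by (ior (iff_fwd _ _ _ (pair_mem _ _ _ _ y e) (pair_mem_r _ _ _ _ Hp)) as k; exact k).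
    pose proof (prf_ImpE _ _ _ _ (prf_ImpE _ _ _ _ (single y p') e1)
      (iff_fwd _ _ _ (opair_mem _ _ _ _ p' H) h')) as k.
    apply eq_trans with x; [exact e1|]. apply eq_sym.
    ior (iff_fwd _ _ _ (pair_mem _ _ _ _ y' k) (pair_mem_r _ _ _ _ Hp')) as m; exact m.
  - ior (iff_fwd _ _ _ (pair_mem _ _ _ _ y e) (pair_mem_r _ _ _ _ Hp)) as k; [|exact k].
    pose proof (pair_mem_r _ _ _ _ e) as m.
    ior (iff_fwd _ _ _ (pair_mem _ _ _ _ y' Hp) m) as m1.
    + apply eq_trans with x; [exact k | apply eq_sym; exact m1].
    + apply eq_sym; exact m1.
Qed.

Lemma rel_intro G f x y z : G ⊢ IsOPair x y z -> G ⊢ z ∈ f -> G ⊢ Rel f x y.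
Proof. intros H h; exact (exin_intro _ _ (IsOPair (S x) (S y) 0) z h H). Qed.

Lemma rel_opair G f x y z : G ⊢ Rel f x y -> G ⊢ IsOPair x y z -> G ⊢ z ∈ f.
Proof.
  intros H Hz. iexin H as z' h H'.
  apply mem_eq_l with z'; [|exact h]. exact (opair_eq _ _ _ _ _ H' Hz).
Qed.

Lemma map_opair G f X E z :
  G ⊢ IsMap f X E -> G ⊢ z ∈ f ->
  G ⊢ ExIn X (ExIn (S E) (IsOPair 1 0 (S (S z)))).
Proof.
  intros H Hz; iand H as [H _]. exact (allin_elim _ _ _ z H Hz).
Qed.

Lemma map_dom G f X E x y : G ⊢ IsMap f X E -> G ⊢ Rel f x y -> G ⊢ x ∈ X.
Proof.
  intros H h. iexin h as z hz Hz.
  iexin (map_opair _ _ _ _ _ H hz) as x' hx h. iexin h as y' hy h.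
  apply mem_eq_l with x'; [|exact hx]. exact (opair_inj_l _ _ _ _ _ _ h Hz).
Qed.

Lemma map_cod G f X E x y : G ⊢ IsMap f X E -> G ⊢ Rel f x y -> G ⊢ y ∈ E.
Proof.
  intros H h. iexin h as z hz Hz.
  iexin (map_opair _ _ _ _ _ H hz) as x' hx h. iexin h as y' hy h.
  apply mem_eq_l with y'; [|exact hy]. exact (opair_inj_r _ _ _ _ _ _ h Hz).
Qed.

Lemma map_exu G f X E x :
  G ⊢ IsMap f X E -> G ⊢ x ∈ X -> G ⊢ ExUnique (Rel (S f) (S x) 0).
Proof.
  intros H h; iand H as [_ H].
  pose proof (allin_elim _ _ _ x H h) as k; simp_form_in k; exact k.
Qed.

Lemma map_val G f X E x :
  G ⊢ IsMap f X E -> G ⊢ x ∈ X -> G ⊢ Ex (Rel (S f) (S x) 0).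
Proof.
  intros H h. iexu (map_exu _ _ _ _ _ H h) as y hy. iexists y. exact hy.
Qed.

Lemma map_fun G f X E x y y' :
  G ⊢ IsMap f X E -> G ⊢ Rel f x y -> G ⊢ Rel f x y' -> G ⊢ y ≐ y'.
Proof.
  intros H h h'. pose proof (map_exu _ _ _ _ _ H (map_dom _ _ _ _ _ _ H h)) as U.
  apply (exu_uniq _ _ y y' U); simp_form; assumption.
Qed.

(** Closes a goal that differs from [H] only in how one renaming of the same formula is factored.
    The composites are compared at 0, at 1 and at the larger indices. *)
Ltac exact_ren H :=
  let h := fresh in pose proof H as h; unfold subst1, subst0 in h; unfold subst1, subst0;
  rewrite ?ren_ren in h; rewrite ?ren_ren;
  erewrite ren_ext; [exact h | let k := fresh in intros [|[|k]]; reflexivity].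

(** In [A], the argument is the variable [1] and the value the variable [0]. *)
Lemma map_from_ex A X E G :
  (forall x, G ⊢ x ∈ X ⟶ Ex (0 ∈ S E ⋏ ren (up (inst x)) A)) ->
  (forall x y y', G ⊢ x ∈ X ⟶ y ∈ E ⟶ y' ∈ E ⟶
    subst1 A x y ⟶ subst1 A x y' ⟶ y ≐ y') ->
  G ⊢ Ex (IsMap 0 (S X) (S E) ⋏
          All (All (Rel 2 1 0 ⟷ 1 ∈ 3 + X ⋏ 0 ∈ 3 + E ⋏ ren (up (up S)) A))).
Proof.
  intros Htot Hfun.
  (* Replacement yields a set of values, so the functional formula sends x to the ordered pair ⟨x,
     y⟩ rather than to y. The resulting set is then the graph itself. *)
  pose (B := Ex (0 ∈ 3 + E ⋏ ren (fun k => match k with 0 => 0 | S k => S (S k) end) A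
                 ⋏ IsOPair 2 0 1)).
  assert (R : G ⊢ Replacement X B) by (apply prf_Ax, (theory_CZF0 _ HT), Ax_repl).
  assert (Bin : forall G' x y z, G' ⊢ y ∈ E -> G' ⊢ subst1 A x y ->
     G' ⊢ IsOPair x y z -> G' ⊢ subst1 B x z).
  { intros G' x y z hy hA hz. unfold B, subst1, subst0; cbn [ren]; iexists y.
    isplit; [exact hy|]. isplit; [exact_ren hA | exact hz]. }
  assert (Bel : forall G' x z, G' ⊢ subst1 B x z ->
     G' ⊢ Ex (0 ∈ S E ⋏ ren (up (inst x)) A ⋏ IsOPair (S x) 0 (S z))).
  { intros G' x z h. unfold B, subst1, subst0 in h; cbn [ren] in h; iex h as y h. iexists y.
    iand h as [hy h]; iand h as [hA h]. isplit; [exact hy|]. isplit; [exact_ren hA | exact h]. }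
  clearbody B.
  assert (Tot : G ⊢ AllIn X (ExUnique B)).
  { apply allin_intro; step; intros x hx; unfold subst0; rewrite ren_ExUnique.
    iex (prf_ImpE _ _ _ _ (Htot x) hx) as y h. iand h as [hy h].
    iex (opair_ex G x y) as z hz.
    apply exu_intro with z.
    - apply (Bin _ x y z hy); [exact_ren h | exact hz].
    - step; intros z' hz'.
      iex (Bel _ _ _ hz') as y' h'. iand h' as [hy' h']. iand h' as [hA' h'].
      apply opair_eq with x y; [|exact hz].
      assert (e : G ⊢ y' ≐ y).
      { refine (prf_ImpE _ _ _ _ (prf_ImpE _ _ _ _ (prf_ImpE _ _ _ _ (prf_ImpE _ _ _ _
          (prf_ImpE _ _ _ _ (Hfun x y' y) hx) hy') hy) _) _); [exact_ren hA' | exact_ren h]. }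
      irewrite <- e. exact h'. }
  pose proof (prf_ImpE _ _ _ _ R Tot) as R'.
  iex R' as f Hf. iexists f.
  assert (Fin : forall x z, G ⊢ x ∈ X ⟶ subst1 B x z ⟶ z ∈ f).
  { intros x z. iintro hx. iintro h.
    apply (iff_bwd _ _ _ (prf_AllE _ _ _ z Hf)).
    apply (exin_intro _ _ _ x hx). exact_ren h. }
  assert (Fel : forall z, G ⊢ z ∈ f ⟶
    Ex (0 ∈ S X ⋏ Ex (0 ∈ 2 + E ⋏ ren (fun k => match k with S (S k) => 2 + k | _ => k end) A
       ⋏ IsOPair 1 0 (2 + z)))).
  { intros z. iintro h. pose proof (iff_fwd _ _ _ (prf_AllE _ _ _ z Hf) h) as k.
    iexin k as x hx k. iexists x. isplit; [exact hx|].
    assert (k' : G ⊢ subst1 B x z) by exact_ren k.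
    iex (Bel _ _ _ k') as y h'. iexists y.
    iand h' as [hy h']. iand h' as [hA h'].
    isplit; [exact hy|]. isplit; [exact_ren hA | exact h']. }
  assert (Rel_iff : forall x y, G ⊢ Rel f x y ⟷ x ∈ X ⋏ y ∈ E ⋏ subst1 A x y).
  { intros x y; iiff h.
    - iexin h as z hz h.
      iex (prf_ImpE _ _ _ _ (Fel z) hz) as x' k. iand k as [hx k].
      iex k as y' k. iand k as [hy k]. iand k as [hA k].
      pose proof (opair_inj_l _ _ _ _ _ _ k h) as ex.
      pose proof (opair_inj_r _ _ _ _ _ _ k h) as ey.
      isplit; [exact (mem_eq_l _ _ _ _ ex hx)|].
      isplit; [exact (mem_eq_l _ _ _ _ ey hy)|].
      assert (k1 : G ⊢ subst1 A x' y') by exact_ren hA.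
      (* Equality elimination acts on variable 0 only. The value is replaced first, with x' already
         substituted; for the argument, [inst (S y)] fills in the value and moves the argument to
         index 0. *)
      assert (k2 : G ⊢ subst1 A x' y).
      { refine (prf_EqE _ _ (ren (up (inst x')) A) _ _ ey _); exact k1. }
      assert (k3 : G ⊢ subst0 (ren (inst (S y)) A) x).
      { refine (prf_EqE _ _ (ren (inst (S y)) A) x' x ex _). exact_ren k2. }
      exact_ren k3.
    - iand h as [hx h]. iand h as [hy h]. iex (opair_ex G x y) as z hz.
      apply (rel_intro _ _ _ _ z hz).
      exact (prf_ImpE _ _ _ _ (prf_ImpE _ _ _ _ (Fin x z) hx) (Bin _ _ _ _ hy h hz)). }
  isplit.
  - isplit.
    + iintroin z hz. iex (prf_ImpE _ _ _ _ (Fel z) hz) as x h. iand h as [hx h].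
      apply (exin_intro _ _ _ x hx). iex h as y h. iand h as [hy h]. iand h as [hA h].
      apply (exin_intro _ _ _ y hy). exact h.
    + iintroin x hx. iex (prf_ImpE _ _ _ _ (Htot x) hx) as y h. iand h as [hy h].
      apply exu_intro with y.
      * simp_form. apply (iff_bwd _ _ _ (Rel_iff x y)).
        isplit; [exact hx|]. isplit; [exact hy | exact h].
      * step; intros y' h'; simp_form_in h'.
        apply (iff_fwd _ _ _ (Rel_iff x y')) in h'. iand h' as [_ h']. iand h' as [hy' h'].
        refine (prf_ImpE _ _ _ _ (prf_ImpE _ _ _ _ (prf_ImpE _ _ _ _ (prf_ImpE _ _ _ _
          (prf_ImpE _ _ _ _ (Hfun x y' y) hx) hy') hy) _) _); [exact_ren h' | exact_ren h].
  - iintro x. iintro y. simp_form.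
    pose proof (Rel_iff x y) as h.
    replace (ren (inst y) _) with (subst1 A x y); [exact h|].
    unfold subst1, subst0; rewrite !ren_ren; apply ren_ext; intros [|[|k]]; reflexivity.
Qed.

Lemma map_from A X E G C :
  (forall x, G ⊢ x ∈ X ⟶ Ex (0 ∈ S E ⋏ ren (up (inst x)) A)) ->
  (forall x y y', G ⊢ x ∈ X ⟶ y ∈ E ⟶ y' ∈ E ⟶
    subst1 A x y ⟶ subst1 A x y' ⟶ y ≐ y') ->
  (forall G', incl G G' -> forall f, G' ⊢ IsMap f X E ->
    (forall x y, G' ⊢ Rel f x y ⟷ x ∈ X ⋏ y ∈ E ⋏ subst1 A x y) -> G' ⊢ C) ->
  G ⊢ C.
Proof.
  intros Htot Hfun H.
  apply (ex_elim _ _ _ (map_from_ex _ _ _ _ Htot Hfun)); intros G' L f h.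
  iand h as [hf h]. apply (H G' L f hf); intros x y.
  pose proof (prf_AllE _ _ _ y (prf_AllE _ _ _ x h)) as k; simp_form_in k.
  replace (subst1 A x y) with (ren (inst y) (ren (up (inst x)) (ren (up (up (inst f))) (ren (up (up S)) A)))); [exact k|].
  unfold subst1, subst0; rewrite !ren_ren; apply ren_ext; intros [|[|i]]; reflexivity.
Qed.

(** * Restricted formulas and separation *)

Tactic Notation "ifwd" constr(H) constr(h) "as" ident(k) :=
  pose proof (iff_fwd _ _ _ H h) as k; simp_form_in k.
Tactic Notation "ibwd" constr(H) := refine (iff_bwd _ _ _ H _); simp_form.
Tactic Notation "iall" constr(H) constr(x) "as" ident(k) :=
  pose proof (prf_AllE _ _ _ x H) as k; simp_form_in k.
Tactic Notation "iallin" constr(H) constr(h) "as" ident(k) :=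
  pose proof (allin_elim _ _ _ _ H h) as k; simp_form_in k.

(** [IsPair], hence [IsOPair] and [Rel], is not literally restricted, only
    provably equivalent to a restricted formula. *)
Definition delta0 A : Prop := exists B, restricted B /\ forall G, G ⊢ A ⟷ B.

Lemma delta0_restricted A : restricted A -> delta0 A.
Proof. intros H; exists A; split; [exact H|]; intros G; iiff h; exact h. Qed.

Lemma delta0_iff A B : (forall G, G ⊢ A ⟷ B) -> delta0 B -> delta0 A.
Proof.
  intros H (C & HC & E); exists C; split; [exact HC|]; intros G.
  exact (iff_trans _ _ _ _ (H G) (E G)).
Qed.

Lemma delta0_bot : delta0 Bot.
Proof. apply delta0_restricted; constructor. Qed.

Lemma delta0_mem x y : delta0 (x ∈ y).
Proof. apply delta0_restricted; constructor. Qed.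

Lemma delta0_eq x y : delta0 (x ≐ y).
Proof. apply delta0_restricted; constructor. Qed.

Lemma delta0_and A B : delta0 A -> delta0 B -> delta0 (A ⋏ B).
Proof.
  intros (A' & RA & EA) (B' & RB & EB); exists (A' ⋏ B'); split; [now constructor|].
  intros G; iiff h; iand h as [h h']; isplit.
  - exact (iff_fwd _ _ _ (EA _) h).
  - exact (iff_fwd _ _ _ (EB _) h').
  - exact (iff_bwd _ _ _ (EA _) h).
  - exact (iff_bwd _ _ _ (EB _) h').
Qed.

Lemma delta0_or A B : delta0 A -> delta0 B -> delta0 (A ⋎ B).
Proof.
  intros (A' & RA & EA) (B' & RB & EB); exists (A' ⋎ B'); split; [now constructor|].
  intros G; iiff h; ior h as h.
  - ileft; exact (iff_fwd _ _ _ (EA _) h).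
  - iright; exact (iff_fwd _ _ _ (EB _) h).
  - ileft; exact (iff_bwd _ _ _ (EA _) h).
  - iright; exact (iff_bwd _ _ _ (EB _) h).
Qed.

Lemma delta0_imp A B : delta0 A -> delta0 B -> delta0 (A ⟶ B).
Proof.
  intros (A' & RA & EA) (B' & RB & EB); exists (A' ⟶ B'); split; [now constructor|].
  intros G; iiff h; iintro k.
  - apply (iff_fwd _ _ _ (EB _)), (prf_ImpE _ _ _ _ h), (iff_bwd _ _ _ (EA _) k).
  - apply (iff_bwd _ _ _ (EB _)), (prf_ImpE _ _ _ _ h), (iff_fwd _ _ _ (EA _) k).
Qed.

(** Having the equivalence in every context, in particular in the shifted one, allows generalising
    and then instantiating it. This is why [delta0] quantifies over contexts. *)
Lemma iff_subst0 A B : (forall G, G ⊢ A ⟷ B) -> forall G x, G ⊢ subst0 A x ⟷ subst0 B x.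
Proof. intros H G x; exact (prf_AllE _ _ _ x (prf_AllI _ _ _ (H _))). Qed.

Lemma delta0_allin x A : delta0 A -> delta0 (AllIn x A).
Proof.
  intros (A' & RA & EA); exists (AllIn x A'); split; [now constructor|].
  intros G; iiff h; apply allin_intro; step; intros z hz.
  - exact (iff_fwd _ _ _ (iff_subst0 _ _ EA _ z) (allin_elim _ _ _ z h hz)).
  - exact (iff_bwd _ _ _ (iff_subst0 _ _ EA _ z) (allin_elim _ _ _ z h hz)).
Qed.

Lemma delta0_exin x A : delta0 A -> delta0 (ExIn x A).
Proof.
  intros (A' & RA & EA); exists (ExIn x A'); split; [now constructor|].
  intros G; iiff h; apply (exin_elim _ _ _ _ h); step; intros z hz k;
    apply (exin_intro _ _ _ z hz).
  - exact (iff_fwd _ _ _ (iff_subst0 _ _ EA _ z) k).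
  - exact (iff_bwd _ _ _ (iff_subst0 _ _ EA _ z) k).
Qed.

(** The unbounded direction, that x and y belong to z, is replaced by two membership statements. *)
Lemma delta0_pair x y z : delta0 (IsPair x y z).
Proof.
  apply delta0_iff with (x ∈ z ⋏ y ∈ z ⋏ AllIn z (0 ≐ S x ⋎ 0 ≐ S y)).
  - intros G; iiff h.
    + isplit; [exact (pair_mem_l _ _ _ _ h)|].
      isplit; [exact (pair_mem_r _ _ _ _ h)|].
      iintroin w hw. exact (iff_fwd _ _ _ (pair_mem _ _ _ _ w h) hw).
    + iand h as [hx h]; iand h as [hy h]. unfold IsPair; iintro w; iiff k.
      * iallin h k as k'; exact k'.
      * ior k as k; irewrite -> k; assumption.
  - apply delta0_restricted; repeat constructor.
Qed.

(** The sets {x} and {x, y} exist by pairing and are unique by extensionality, so asking that z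
    contain a copy of each bounds the unbounded direction. *)
Lemma delta0_opair x y z : delta0 (IsOPair x y z).
Proof.
  apply delta0_iff with
    (ExIn z (IsPair (S x) (S x) 0) ⋏ ExIn z (IsPair (S x) (S y) 0) ⋏
     AllIn z (IsPair (S x) (S x) 0 ⋎ IsPair (S x) (S y) 0)).
  - intros G; iiff h.
    + iex (pair_ex G x x) as s hs. iex (pair_ex G x y) as p hp.
      isplit; [apply exin_intro with s|isplit; [apply exin_intro with p|]].
      * ibwd (opair_mem _ _ _ _ s h). ileft; exact hs.
      * exact hs.
      * ibwd (opair_mem _ _ _ _ p h). iright; exact hp.
      * exact hp.
      * iintroin w hw. exact (iff_fwd _ _ _ (opair_mem _ _ _ _ w h) hw).
    + iand h as [hs h]; iand h as [hp h]. unfold IsOPair; iintro w; iiff k.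
      * iallin h k as k'; exact k'.
      * ior k as k.
        -- iexin hs as s hs hs'. apply mem_eq_l with s; [|exact hs].
           exact (pair_eq _ _ _ _ _ hs' k).
        -- iexin hp as p hp hp'. apply mem_eq_l with p; [|exact hp].
           exact (pair_eq _ _ _ _ _ hp' k).
  - repeat first [apply delta0_and | apply delta0_exin | apply delta0_allin
      | apply delta0_or | apply delta0_pair].
Qed.

Lemma delta0_rel f x y : delta0 (Rel f x y).
Proof. apply delta0_exin, delta0_opair. Qed.

Hint Resolve delta0_bot delta0_mem delta0_eq delta0_and delta0_or delta0_imp
  delta0_allin delta0_exin delta0_pair delta0_opair delta0_rel : delta0.

Lemma separation A a G C :
  delta0 A ->
  (forall G', incl G G' -> forall s,
    (forall z, G' ⊢ z ∈ s ⟷ z ∈ a ⋏ subst0 A z) -> G' ⊢ C) -> G ⊢ C.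
Proof.
  intros (B & RB & E) H.
  assert (Ax : G ⊢ Separation a B) by now apply prf_Ax, (theory_CZF0 _ HT), Ax_sep.
  apply (ex_elim _ _ _ Ax); intros G' L s hs; apply (H G' L s); intros z; clear L.
  iall hs z as k. fold (subst0 (ren (up (inst s)) (ren (up S) B)) z) in k.
  rewrite subst0_up_S in k.
  apply iff_trans with (z ∈ a ⋏ subst0 B z); [exact k|].
  pose proof (iff_subst0 _ _ E G' z) as e.
  iiff h; iand h as [h h']; isplit; try exact h.
  - exact (iff_bwd _ _ _ e h').
  - exact (iff_fwd _ _ _ e h').
Qed.

Tactic Notation "isep" constr(A) constr(a) "as" ident(s) ident(h) :=
  apply (separation A a); [auto 20 with delta0 | step; intros s h].

Lemma subset_mem G X Y x : G ⊢ Subset X Y -> G ⊢ x ∈ X -> G ⊢ x ∈ Y.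
Proof. intros H h; iallin H h as k; exact k. Qed.

(** For graphs of maps, restriction is inclusion: a pair of [g] over x in X agrees with the pair of
    [f] over x, since [g] contains both and is functional. *)
Lemma restriction_iff G f g X Y E :
  G ⊢ Subset X Y -> G ⊢ IsMap f X E -> G ⊢ IsMap g Y E ->
  G ⊢ IsRestriction g X f ⟷ All (All (Rel (2 + f) 1 0 ⟶ Rel (2 + g) 1 0)).
Proof.
  intros HS Hf Hg; iiff h.
  - iintro x. iintro y. iintro k. iexin k as z hz k.
    apply rel_intro with z; [exact k|]. iall h z as h'. ifwd h' hz as l.
    iand l as [l _]; exact l.
  - unfold IsRestriction; iintro z; iiff k.
    + iexin (map_opair _ _ _ _ _ Hf k) as x hx l. iexin l as y hy l.
      isplit.
      * iall h x as h'; iall h' y as h''.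
        apply rel_opair with x y; [|exact l]. apply (prf_ImpE _ _ _ _ h'').
        exact (rel_intro _ _ _ _ _ l k).
      * apply exin_intro with x; [exact hx|]. simp_form. iexists y. exact l.
    + iand k as [k l]. iexin l as x hx l. iex l as y l.
      iex (map_val _ _ _ _ _ Hf hx) as y' h'.
      iall h x as h1; iall h1 y' as h2.
      assert (e : G ⊢ y' ≐ y).
      { apply (map_fun _ _ _ _ _ _ _ Hg (prf_ImpE _ _ _ _ h2 h')).
        exact (rel_intro _ _ _ _ _ l k). }
      apply rel_opair with x y; [|exact l]. irewrite <- e. exact h'.
Qed.

(** * Injective sets *)

Lemma injective_extend G E X Y f C :
  G ⊢ IsInjective E -> G ⊢ Subset X Y -> G ⊢ IsMap f X E ->
  (forall G', incl G G' -> forall g, G' ⊢ IsMap g Y E ->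
    (forall x y, G' ⊢ Rel f x y ⟶ Rel g x y) -> G' ⊢ C) -> G ⊢ C.
Proof.
  intros HE HS Hf H.
  iall HE X as h. iall h Y as h'. pose proof (prf_ImpE _ _ _ _ h' HS) as h1; simp_form_in h1.
  iall h1 f as h2. pose proof (prf_ImpE _ _ _ _ h2 Hf) as h3.
  apply (ex_elim _ _ _ h3); intros G' L g k; simp_form_in k. iand k as [hg k].
  apply (H G' L g hg). intros x y.
  pose proof (iff_fwd _ _ _ (restriction_iff _ _ _ _ _ _
    (weaken _ _ HS _ L) (weaken _ _ Hf _ L) hg) k) as l.
  iall l x as l1; iall l1 y as l2; exact l2.
Qed.

Lemma injective_intro G E :
  (forall G', incl G G' -> forall X Y f, G' ⊢ Subset X Y -> G' ⊢ IsMap f X E ->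
    G' ⊢ Ex (IsMap 0 (S Y) (S E) ⋏ All (All (Rel (3 + f) 1 0 ⟶ Rel 2 1 0)))) ->
  G ⊢ IsInjective E.
Proof.
  intros H. unfold IsInjective. apply all_intro; intros X; simp_form.
  apply all_intro; intros Y; simp_form. apply imp_intro; intros G1 L1 HS.
  apply all_intro; intros f; simp_form. apply imp_intro; intros G2 L2 Hf.
  assert (HS2 : G2 ⊢ Subset X Y) by exact (weaken _ _ HS _ L2).
  pose proof (H G2 (incl_tran L1 L2) X Y f HS2 Hf) as h; clear L1 L2 HS.
  iex h as g h.
  iand h as [hg h]. iexists g. isplit; [exact hg|].
  exact (iff_bwd _ _ _ (restriction_iff _ _ _ _ _ _ HS2 Hf hg) h).
Qed.

Tactic Notation "imapfrom" constr(A) constr(X) constr(E) "as" ident(f) ident(hf) ident(hr) :=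
  apply (map_from A X E); [| | step; intros f hf hr].

Lemma injective_singleton G E a :
  G ⊢ a ∈ E -> (forall e, G ⊢ e ∈ E ⟶ e ≐ a) -> G ⊢ IsInjective E.
Proof.
  intros ha hE. apply injective_intro; step; intros X Y f HS Hf.
  (* With a single possible value, the always true relation already defines the constant map. *)
  imapfrom (0 ≐ 0) Y E as g hg hr.
  - intros y; iintro hy. iexists a. isplit; [exact ha | apply prf_EqI].
  - intros x y y'. iintro hx. iintro hy. iintro hy'. iintro e. iintro e'.
    apply eq_trans with a; [|apply eq_sym].
    + exact (prf_ImpE _ _ _ _ (hE y) hy).
    + exact (prf_ImpE _ _ _ _ (hE y') hy').
  - iexists g. isplit; [exact hg|]. iintro x. iintro y. iintro k.
    ibwd (hr x y). isplit; [|isplit; [|apply prf_EqI]].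
    + exact (subset_mem _ _ _ _ HS (map_dom _ _ _ _ _ _ Hf k)).
    + exact (map_cod _ _ _ _ _ _ Hf k).
Qed.

Lemma injective_union G U V E :
  (forall A G, delta0 A -> G ⊢ ¬ A ⋎ ¬ ¬ A) ->
  (forall e, G ⊢ e ∈ E ⟷ e ∈ U ⋎ e ∈ V) ->
  (forall e, G ⊢ e ∈ U ⟶ e ∈ V ⟶ Bot) ->
  G ⊢ IsInjective U -> G ⊢ IsInjective V -> G ⊢ IsInjective E.
Proof.
  intros wem hE hUV HU HV. apply injective_intro; step; intros X Y f HS Hf.
  (* The condition is about the graph of [f], so it applies to all of Y; a point outside X has no
     related element and falls into [Y1]. *)
  isep (¬ ExIn (S V) (Rel (2 + f) 1 0)) X as X1 hX1.
  isep (¬ ¬ ExIn (S V) (Rel (2 + f) 1 0)) X as X2 hX2.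
  isep (¬ ExIn (S V) (Rel (2 + f) 1 0)) Y as Y1 hY1.
  isep (¬ ¬ ExIn (S V) (Rel (2 + f) 1 0)) Y as Y2 hY2.
  assert (HS1 : G ⊢ Subset X1 Y1).
  { iintroin x hx. ifwd (hX1 x) hx as k. iand k as [hx' k].
    ibwd (hY1 x). isplit; [exact (subset_mem _ _ _ _ HS hx') | exact k]. }
  assert (HS2 : G ⊢ Subset X2 Y2).
  { iintroin x hx. ifwd (hX2 x) hx as k. iand k as [hx' k].
    ibwd (hY2 x). isplit; [exact (subset_mem _ _ _ _ HS hx') | exact k]. }
  imapfrom (Rel (2 + f) 1 0) X1 U as f1 hf1 hr1.
  { intros x. iintro hx. ifwd (hX1 x) hx as k. iand k as [hx' k].
    iex (map_val _ _ _ _ _ Hf hx') as y hy. iexists y. isplit; [|exact hy].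
    ior (iff_fwd _ _ _ (hE y) (map_cod _ _ _ _ _ _ Hf hy)) as l; [exact l|].
    iabsurd. apply (prf_ImpE _ _ _ _ k). apply exin_intro with y; [exact l | exact hy]. }
  { intros x y y'. iintro hx. iintro hy. iintro hy'. iintro e. iintro e'.
    exact (map_fun _ _ _ _ _ _ _ Hf e e'). }
  (* A value in U would, by disjointness, refute every related element of V, against the double
     negation. *)
  imapfrom (Rel (2 + f) 1 0) X2 V as f2 hf2 hr2.
  { intros x. iintro hx. ifwd (hX2 x) hx as k. iand k as [hx' k].
    iex (map_val _ _ _ _ _ Hf hx') as y hy. iexists y. isplit; [|exact hy].
    ior (iff_fwd _ _ _ (hE y) (map_cod _ _ _ _ _ _ Hf hy)) as l; [|exact l].
    iabsurd. apply (prf_ImpE _ _ _ _ k). iintro m. iexin m as y' hy' m.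
    apply (prf_ImpE _ _ _ _ (prf_ImpE _ _ _ _ (hUV y) l)).
    exact (mem_eq_l _ _ _ _ (map_fun _ _ _ _ _ _ _ Hf m hy) hy'). }
  { intros x y y'. iintro hx. iintro hy. iintro hy'. iintro e. iintro e'.
    exact (map_fun _ _ _ _ _ _ _ Hf e e'). }
  apply (injective_extend _ _ _ _ _ _ HU HS1 hf1); step; intros g1 hg1 e1.
  apply (injective_extend _ _ _ _ _ _ HV HS2 hf2); step; intros g2 hg2 e2.
  imapfrom (Rel (2 + g1) 1 0 ⋎ Rel (2 + g2) 1 0) Y E as g hg hr.
  { intros x. iintro hx.
    (* Weak excluded middle is applied here alone: it makes [Y1] and [Y2] cover Y, so that [g1] and
       [g2] together are total. *)
    ior (wem (ExIn V (Rel (S f) (S x) 0)) G ltac:(auto with delta0)) as k.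
    - assert (hx1 : G ⊢ x ∈ Y1) by (ibwd (hY1 x); isplit; [exact hx | exact k]).
      iex (map_val _ _ _ _ _ hg1 hx1) as y hy. iexists y. isplit.
      + ibwd (hE y). ileft. exact (map_cod _ _ _ _ _ _ hg1 hy).
      + ileft; exact hy.
    - assert (hx2 : G ⊢ x ∈ Y2) by (ibwd (hY2 x); isplit; [exact hx | exact k]).
      iex (map_val _ _ _ _ _ hg2 hx2) as y hy. iexists y. isplit.
      + ibwd (hE y). iright. exact (map_cod _ _ _ _ _ _ hg2 hy).
      + iright; exact hy. }
  { assert (sep : forall x y y', G ⊢ Rel g1 x y ⟶ Rel g2 x y' ⟶ Bot).
    { intros x y y'. iintro k. iintro l.
      ifwd (hY1 x) (map_dom _ _ _ _ _ _ hg1 k) as k'. iand k' as [_ k'].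
      ifwd (hY2 x) (map_dom _ _ _ _ _ _ hg2 l) as l'. iand l' as [_ l'].
      exact (prf_ImpE _ _ _ _ l' k'). }
    intros x y y'. iintro hx. iintro hy. iintro hy'. iintro k. iintro l.
    unfold subst1 in *; simp_form_in k; simp_form_in l.
    ior k as k; ior l as l.
    - exact (map_fun _ _ _ _ _ _ _ hg1 k l).
    - iabsurd. exact (prf_ImpE _ _ _ _ (prf_ImpE _ _ _ _ (sep x y y') k) l).
    - iabsurd. exact (prf_ImpE _ _ _ _ (prf_ImpE _ _ _ _ (sep x y' y) l) k).
    - exact (map_fun _ _ _ _ _ _ _ hg2 k l). }
  iexists g. isplit; [exact hg|]. iintro x. iintro y. iintro k.
  pose proof (map_dom _ _ _ _ _ _ Hf k) as hx.
  pose proof (map_cod _ _ _ _ _ _ Hf k) as hy.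
  ibwd (hr x y). isplit; [exact (subset_mem _ _ _ _ HS hx)|]. isplit; [exact hy|].
  (* On X the value chooses the part: lying in U refutes the condition by disjointness, and lying in
     V witnesses it. *)
  ior (iff_fwd _ _ _ (hE y) hy) as l.
  - ileft. apply (prf_ImpE _ _ _ _ (e1 x y)). ibwd (hr1 x y).
    isplit; [|isplit; [exact l | exact k]].
    ibwd (hX1 x). isplit; [exact hx|]. iintro m. iexin m as y' hy' m.
    apply (prf_ImpE _ _ _ _ (prf_ImpE _ _ _ _ (hUV y) l)).
    exact (mem_eq_l _ _ _ _ (map_fun _ _ _ _ _ _ _ Hf m k) hy').
  - iright. apply (prf_ImpE _ _ _ _ (e2 x y)). ibwd (hr2 x y).
    isplit; [|isplit; [exact l | exact k]].
    ibwd (hX2 x). isplit; [exact hx|]. iintro m. apply (prf_ImpE _ _ _ _ m).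
    apply exin_intro with y; [exact l | exact k].
Qed.

(** * Natural numbers *)

Lemma nat_ex G : G ⊢ Ex (IsNat 0).
Proof. apply prf_Ax, (theory_CZF0 _ HT), Ax_inf. Qed.

Lemma nat_induction A N G :
  G ⊢ IsNat N -> G ⊢ All (IsEmpty 0 ⟶ A) ->
  G ⊢ AllIn N (A ⟶ All (IsSucc 1 0 ⟶ ren (up S) A)) -> G ⊢ AllIn N A.
Proof.
  intros HN H0 HS.
  assert (Ax : G ⊢ Induction N A) by (apply prf_Ax, (theory_CZF0 _ HT), Ax_ind).
  apply (prf_ImpE _ _ _ _ (prf_ImpE _ _ _ _ Ax HN)). isplit; assumption.
Qed.

Lemma empty_ex G : G ⊢ Ex (IsEmpty 0).
Proof.
  iex (nat_ex G) as N h. iand h as [h _]. iand h as [h _]. iexin h as o ho h.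
  iexists o; exact h.
Qed.

Lemma empty_mem G o x : G ⊢ IsEmpty o -> G ⊢ x ∈ o -> G ⊢ Bot.
Proof. intros H h; iall H x as k; exact (prf_ImpE _ _ _ _ k h). Qed.

Lemma empty_eq G o o' : G ⊢ IsEmpty o -> G ⊢ IsEmpty o' -> G ⊢ o ≐ o'.
Proof.
  intros H H'; apply extensionality; intros x; iiff h; iabsurd.
  - exact (empty_mem _ _ _ H h).
  - exact (empty_mem _ _ _ H' h).
Qed.

Lemma one_mem G i x : G ⊢ IsOne i -> G ⊢ x ∈ i ⟷ IsEmpty x.
Proof. intros H; exact (prf_AllE _ _ _ x H). Qed.

Lemma one_eq G i i' : G ⊢ IsOne i -> G ⊢ IsOne i' -> G ⊢ i ≐ i'.
Proof.
  intros H H'; apply extensionality; intros x.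
  apply iff_trans with (IsEmpty x); [|apply iff_sym]; now apply one_mem.
Qed.

Lemma one_ex G : G ⊢ Ex (IsOne 0).
Proof.
  iex (empty_ex G) as o ho. iex (pair_ex G o o) as i hi. iexists i.
  unfold IsOne; iintro x; iiff h.
  - ior (iff_fwd _ _ _ (pair_mem _ _ _ _ x hi) h) as e; irewrite -> e; exact ho.
  - ibwd (pair_mem _ _ _ _ x hi). ileft. exact (empty_eq _ _ _ h ho).
Qed.

Lemma empty_ne_one G o i : G ⊢ IsEmpty o -> G ⊢ IsOne i -> G ⊢ ¬ o ≐ i.
Proof.
  intros ho hi; iintro e. apply (empty_mem _ o o ho).
  apply mem_eq_r with i; [apply eq_sym; exact e|].
  exact (iff_bwd _ _ _ (one_mem _ _ o hi) ho).
Qed.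

Lemma two_mem G t x : G ⊢ IsTwo t -> G ⊢ x ∈ t ⟷ IsEmpty x ⋎ IsOne x.
Proof. intros H; exact (prf_AllE _ _ _ x H). Qed.

Lemma two_pair G o i t :
  G ⊢ IsEmpty o -> G ⊢ IsOne i -> G ⊢ IsTwo t ⟷ IsPair o i t.
Proof.
  intros ho hi.
  assert (E : forall x, G ⊢ (IsEmpty x ⋎ IsOne x) ⟷ (x ≐ o ⋎ x ≐ i)).
  { intros x; iiff h; ior h as h.
    - ileft; exact (empty_eq _ _ _ h ho).
    - iright; exact (one_eq _ _ _ h hi).
    - ileft; irewrite -> h; exact ho.
    - iright; irewrite -> h; exact hi. }
  iiff h.
  - unfold IsPair; iintro x. exact (iff_trans _ _ _ _ (two_mem _ _ x h) (E x)).
  - unfold IsTwo; iintro x.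
    exact (iff_trans _ _ _ _ (pair_mem _ _ _ _ x h) (iff_sym _ _ _ (E x))).
Qed.

Lemma two_ex G : G ⊢ Ex (IsTwo 0).
Proof.
  iex (empty_ex G) as o ho. iex (one_ex G) as i hi. iex (pair_ex G o i) as t h.
  iexists t. exact (iff_bwd _ _ _ (two_pair _ _ _ _ ho hi) h).
Qed.

Lemma succ_mem G x y z : G ⊢ IsSucc x y -> G ⊢ z ∈ y ⟷ z ∈ x ⋎ z ≐ x.
Proof. intros H; exact (prf_AllE _ _ _ z H). Qed.

Lemma succ_mem_self G x y : G ⊢ IsSucc x y -> G ⊢ x ∈ y.
Proof. intros H; ibwd (succ_mem _ _ _ x H); iright; apply prf_EqI. Qed.

Lemma two_in_nat G N t : G ⊢ IsNat N -> G ⊢ IsTwo t -> G ⊢ t ∈ N.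
Proof.
  intros h ht. iand h as [h _]. iand h as [h hs]. iexin h as o hoN ho.
  iallin hs hoN as k. iexin k as i hiN k.
  assert (hi : G ⊢ IsOne i).
  { unfold IsOne; iintro x; iiff h.
    - ior (iff_fwd _ _ _ (succ_mem _ _ _ x k) h) as l.
      + iabsurd; exact (empty_mem _ _ _ ho l).
      + irewrite -> l; exact ho.
    - ibwd (succ_mem _ _ _ x k). iright; exact (empty_eq _ _ _ h ho). }
  iallin hs hiN as k'. iexin k' as t' htN k'.
  apply mem_eq_l with t'; [|exact htN]. apply extensionality; intros x.
  apply iff_trans with (x ∈ i ⋎ x ≐ i); [exact (succ_mem _ _ _ x k')|].
  apply iff_sym, iff_trans with (IsEmpty x ⋎ IsOne x); [exact (two_mem _ _ x ht)|].
  iiff h; ior h as h.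
  - ileft; exact (iff_bwd _ _ _ (one_mem _ _ x hi) h).
  - iright; exact (one_eq _ _ _ h hi).
  - ileft; exact (iff_fwd _ _ _ (one_mem _ _ x hi) h).
  - iright; irewrite -> h; exact hi.
Qed.

(** Rules out n = 0, over which the total set would be empty and hence not injective. *)
Lemma two_le_inhabited G n : G ⊢ TwoLe n -> G ⊢ Ex (0 ∈ S n).
Proof.
  intros h; iex h as t h; iand h as [ht h]. ior h as h; [iexists t; exact h|].
  iex (empty_ex G) as o ho. iexists o. apply mem_eq_r with t; [exact h|].
  ibwd (two_mem _ _ o ht). ileft; exact ho.
Qed.

(** Transitivity is carried along to make the induction work. If s = n ∪ {n} were in s, then s is in
    n or equals n, and n in s gives n in n, in the first case by transitivity. *)
Lemma nat_irreflexive G N :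
  G ⊢ IsNat N -> G ⊢ AllIn N (AllIn 0 (Subset 0 1) ⋏ ¬ 0 ∈ 0).
Proof.
  intros HN. apply nat_induction; [exact HN| |].
  - iintro o; iintro ho. isplit.
    + iintroin k hk. iabsurd; exact (empty_mem _ _ _ ho hk).
    + iintro k; exact (empty_mem _ _ _ ho k).
  - iintroin n hn. iintro h; iand h as [ht hi]. iintro s. iintro hs. simp_form. isplit.
    + iintroin k hk. iintroin z hz. ibwd (succ_mem _ _ _ z hs). ileft.
      ior (iff_fwd _ _ _ (succ_mem _ _ _ k hs) hk) as l.
      * iallin ht l as m. exact (subset_mem _ _ _ _ m hz).
      * exact (mem_eq_r _ _ _ _ l hz).
    + pose proof (succ_mem_self _ _ _ hs) as ns.
      iintro k. apply (prf_ImpE _ _ _ _ hi).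
      ior (iff_fwd _ _ _ (succ_mem _ _ _ s hs) k) as l.
      * iallin ht l as m. exact (subset_mem _ _ _ _ m ns).
      * exact (mem_eq_r _ _ _ _ l ns).
Qed.

(** Common source of (2) and (3): [p] is the bijection of a finite set with n, or the first
    projection of a disjoint union. Fibres are described by their elements, so any set having those
    elements will do. *)
Lemma injective_fibration G N n E p :
  (forall A G, delta0 A -> G ⊢ ¬ A ⋎ ¬ ¬ A) ->
  G ⊢ IsNat N -> G ⊢ n ∈ N -> G ⊢ Ex (0 ∈ S n) -> G ⊢ IsMap p E n ->
  (forall i s, G ⊢ i ∈ n ⟶ All (0 ∈ 1 + s ⟷ 0 ∈ 1 + E ⋏ Rel (1 + p) 0 (1 + i)) ⟶
    IsInjective s) ->
  G ⊢ IsInjective E.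
Proof.
  intros wem HN hn hne hp fib.
  (* The claim at m is that the preimage of m under [p] is injective; the first disjunct exempts m =
     0, whose preimage is empty. *)
  pose (A := IsEmpty 0 ⋎ (Subset 0 (1 + n) ⟶
    All (All (0 ∈ 1 ⟷ 0 ∈ 3 + E ⋏ ExIn 2 (Rel (4 + p) 1 0)) ⟶ IsInjective 0))).
  assert (ind : G ⊢ AllIn N A).
  { apply nat_induction; [exact HN| |]; unfold A.
    - iintro o; iintro ho. ileft; exact ho.
    - iintroin m hm. iintro IH. iintro s. iintro hs. simp_form. iright.
      iintro hsn. iintro S0. iintro hS.
      assert (hms : G ⊢ m ∈ s) by exact (succ_mem_self _ _ _ hs).
      assert (hmn : G ⊢ m ∈ n) by exact (subset_mem _ _ _ _ hsn hms).
      ior IH as IH.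
      (* If m = 0, its successor is {m} and the preimage is the single fibre over m. *)
      + apply (prf_ImpE _ _ _ _ (prf_ImpE _ _ _ _ (fib m S0) hmn)). iintro e.
        iall hS e as he. iiff h.
        * ifwd he h as k. iand k as [hE k]. isplit; [exact hE|]. iexin k as i hi k.
          ior (iff_fwd _ _ _ (succ_mem _ _ _ i hs) hi) as l.
          -- iabsurd; exact (empty_mem _ _ _ IH l).
          -- irewrite <- l; exact k.
        * iand h as [hE h]. ibwd he. isplit; [exact hE|].
          apply exin_intro with m; [exact hms | exact h].
      (* Otherwise the preimage of m ∪ {m} is the union of the preimage [U] of m and the fibre [V]
         over m. *)
      + isep (ExIn (1 + m) (Rel (2 + p) 1 0)) E as U hU.
        isep (Rel (1 + p) 0 (1 + m)) E as V hV.
        apply injective_union with U V.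
        * exact wem.
        * intros e; iall hS e as he; iiff h.
          -- ifwd he h as k. iand k as [hE k]. iexin k as i hi k.
             ior (iff_fwd _ _ _ (succ_mem _ _ _ i hs) hi) as l.
             ++ ileft; ibwd (hU e); isplit; [exact hE|].
                apply exin_intro with i; [exact l | exact k].
             ++ iright; ibwd (hV e); isplit; [exact hE|]. irewrite <- l; exact k.
          -- ibwd he. ior h as h.
             ++ ifwd (hU e) h as k. iand k as [hE k]. isplit; [exact hE|].
                iexin k as i hi k. apply exin_intro with i; [|exact k].
                ibwd (succ_mem _ _ _ i hs); ileft; exact hi.
             ++ ifwd (hV e) h as k. iand k as [hE k]. isplit; [exact hE|].
                apply exin_intro with m; [exact hms | exact k].
        (* A common element would have both m and some i in m as value under [p], forcing m in m. *)
        * intros e. iintro h. iintro k.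
          ifwd (hU e) h as h'. ifwd (hV e) k as k'. iand h' as [_ h']. iand k' as [_ k'].
          iexin h' as i hi h'.
          iallin (nat_irreflexive _ _ HN) hm as l. iand l as [_ l].
          apply (prf_ImpE _ _ _ _ l).
          apply mem_eq_l with i; [|exact hi]. exact (map_fun _ _ _ _ _ _ _ hp h' k').
        * assert (hmn' : G ⊢ Subset m n).
          { iintroin z hz. apply (subset_mem _ _ _ _ hsn).
            ibwd (succ_mem _ _ _ z hs); ileft; exact hz. }
          pose proof (prf_ImpE _ _ _ _ IH hmn') as k. iall k U as k'.
          apply (prf_ImpE _ _ _ _ k'). iintro e. exact (hU e).
        * apply (prf_ImpE _ _ _ _ (prf_ImpE _ _ _ _ (fib m V) hmn)). iintro e. exact (hV e). }
  (* The claim at m = n: n is inhabited, and its preimage is all of E. *)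
  iallin ind hn as h. unfold A in h; simp_form_in h. ior h as h.
  - iex hne as x hx. iabsurd; exact (empty_mem _ _ _ h hx).
  - assert (hnn : G ⊢ Subset n n) by (iintroin z hz; exact hz).
    pose proof (prf_ImpE _ _ _ _ h hnn) as k. iall k E as k'.
    apply (prf_ImpE _ _ _ _ k'). iintro e. iiff l.
    + isplit; [exact l|]. iex (map_val _ _ _ _ _ hp l) as i hi.
      apply exin_intro with i; [exact (map_cod _ _ _ _ _ _ hp hi) | exact hi].
    + iand l as [l _]; exact l.
Qed.

(** * The implications *)

Lemma finite_sets_injective :
  (forall A G, delta0 A -> G ⊢ ¬ A ⋎ ¬ ¬ A) -> forall G, G ⊢ FiniteSetsInjective.
Proof.
  intros wem G. iintro N. iintro HN. iintroin n hn. iintro h2. iintro E. iintro h.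
  iex h as f hf. iand hf as [hf hb].
  apply (injective_fibration _ N n E f wem HN hn (two_le_inhabited _ _ h2) hf).
  intros i s. iintro hi. iintro hs. iallin hb hi as u. iexu u as a ha.
  apply injective_singleton with a.
  - iall hs a as hsa. ibwd hsa. isplit; [exact (map_dom _ _ _ _ _ _ hf ha) | exact ha].
  - intros e. iintro he. iall hs e as hse. ifwd hse he as k. iand k as [_ k].
    apply (exu_uniq _ _ e a u); simp_form; assumption.
Qed.

(** The fibre of a disjoint union over i is {i} × F(i), not F(i) itself. A map into it is stripped
    of the tag, extended into [s], and tagged again. *)
Lemma injective_tagged G i s S0 :
  (forall d, G ⊢ d ∈ S0 ⟷ ExIn s (IsOPair (S i) 0 (S d))) ->
  G ⊢ IsInjective s -> G ⊢ IsInjective S0.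
Proof.
  intros hS Hs. apply injective_intro; step; intros X Y f HS Hf.
  imapfrom (Ex (Rel (3 + f) 2 0 ⋏ IsOPair (3 + i) 1 0)) X s as f' hf' hr'.
  { intros x; iintro hx. iex (map_val _ _ _ _ _ Hf hx) as d hd.
    iexin (iff_fwd _ _ _ (hS d) (map_cod _ _ _ _ _ _ Hf hd)) as v hv k.
    iexists v. isplit; [exact hv|]. iexists d. isplit; [exact hd | exact k]. }
  { intros x v v'. iintro hx. iintro hv. iintro hv'. iintro k. iintro k'.
    iex k as d k. iex k' as d' k'. iand k as [hd k]. iand k' as [hd' k'].
    apply opair_inj_r with i i d; [exact k|].
    irewrite -> (map_fun _ _ _ _ _ _ _ Hf hd hd'). exact k'. }
  apply (injective_extend _ _ _ _ _ _ Hs HS hf'); step; intros g' hg' e'.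
  imapfrom (Ex (Rel (3 + g') 2 0 ⋏ IsOPair (3 + i) 0 1)) Y S0 as g hg hr.
  { intros y; iintro hy. iex (map_val _ _ _ _ _ hg' hy) as v hv.
    iex (opair_ex G i v) as d hd. iexists d. isplit.
    - ibwd (hS d). apply exin_intro with v; [|exact hd].
      exact (map_cod _ _ _ _ _ _ hg' hv).
    - iexists v. isplit; [exact hv | exact hd]. }
  { intros y d d'. iintro hy. iintro hd. iintro hd'. iintro k. iintro k'.
    iex k as v k. iex k' as v' k'. iand k as [hv k]. iand k' as [hv' k'].
    apply opair_eq with i v; [exact k|].
    irewrite -> (map_fun _ _ _ _ _ _ _ hg' hv hv'). exact k'. }
  iexists g. isplit; [exact hg|]. iintro x. iintro d. iintro k.
  pose proof (map_dom _ _ _ _ _ _ Hf k) as hx.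
  pose proof (map_cod _ _ _ _ _ _ Hf k) as hd.
  ibwd (hr x d). isplit; [exact (subset_mem _ _ _ _ HS hx)|]. isplit; [exact hd|].
  iexin (iff_fwd _ _ _ (hS d) hd) as v hv l. iexists v. isplit; [|exact l].
  apply (prf_ImpE _ _ _ _ (e' x v)). ibwd (hr' x v). isplit; [exact hx|].
  isplit; [exact hv|]. iexists d. isplit; [exact k | exact l].
Qed.

Lemma disjoint_unions_injective :
  (forall A G, delta0 A -> G ⊢ ¬ A ⋎ ¬ ¬ A) -> forall G, G ⊢ DisjointUnionsInjective.
Proof.
  intros wem G. iintro N. iintro HN. iintroin n hn. iintro h2. iintro C. iintro F.
  iintro hF. iintro hinj. iintro D. iintro hD.
  assert (Del : forall d, G ⊢ d ∈ D ⟶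
    ExIn n (Ex (Ex (Rel (3 + F) 2 1 ⋏ 0 ∈ 1 ⋏ IsOPair 2 0 (3 + d))))).
  { intros d; iintro h. exact (iff_fwd _ _ _ (prf_AllE _ _ _ d hD) h). }
  assert (Din : forall i s x d, G ⊢ Rel F i s ⟶ x ∈ s ⟶ IsOPair i x d ⟶ d ∈ D).
  { intros i s x d; iintro h; iintro k; iintro l. iall hD d as hd; ibwd hd.
    apply exin_intro with i; [exact (map_dom _ _ _ _ _ _ hF h)|]. simp_form.
    iexists s. iexists x. isplit; [exact h|]. isplit; [exact k | exact l]. }
  (* The first projection from D to n. *)
  imapfrom (Ex (IsOPair 1 0 2)) D n as p hp hr.
  { intros d; iintro hd. pose proof (prf_ImpE _ _ _ _ (Del d) hd) as h.
    iexin h as i hi h. iex h as s h. iex h as x h.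
    iand h as [hs h]. iand h as [hx h].
    iexists i. isplit; [exact hi|]. iexists x. exact h. }
  { intros d i i'. iintro hd. iintro hi. iintro hi'. iintro k. iintro k'.
    iex k as x k. iex k' as x' k'. exact (opair_inj_l _ _ _ _ _ _ k k'). }
  apply (injective_fibration _ N n D p wem HN hn (two_le_inhabited _ _ h2) hp).
  intros i S0. iintro hi. iintro hS.
  iex (map_val _ _ _ _ _ hF hi) as s hs.
  iallin hinj hi as k. iall k s as k'. pose proof (prf_ImpE _ _ _ _ k' hs) as hsi.
  apply injective_tagged with i s; [|exact hsi].
  intros d. iall hS d as hd. iiff h.
  - ifwd hd h as l. iand l as [lD l].
    ifwd (hr d i) l as l'. iand l' as [_ l']. iand l' as [_ l']. iex l' as x' l'.
    pose proof (prf_ImpE _ _ _ _ (Del d) lD) as m.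
    iexin m as i' hi' m. iex m as s' m. iex m as x m.
    iand m as [hs' m]. iand m as [hx m].
    (* The tag of [d] is unique, so the member of the family in which its second component lies is
       the value [s] of [F] at [i]. *)
    assert (ei : G ⊢ i ≐ i') by exact (opair_inj_l _ _ _ _ _ _ l' m).
    assert (es : G ⊢ s' ≐ s).
    { apply (map_fun _ _ _ _ _ _ _ hF hs'). irewrite <- ei; exact hs. }
    apply exin_intro with x; [exact (mem_eq_r _ _ _ _ es hx)|].
    simp_form. irewrite -> ei. exact m.
  - iexin h as x hx h. ibwd hd.
    assert (hdD : G ⊢ d ∈ D)
      by exact (prf_ImpE _ _ _ _ (prf_ImpE _ _ _ _ (prf_ImpE _ _ _ _ (Din i s x d) hs) hx) h).
    isplit; [exact hdD|]. ibwd (hr d i).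
    isplit; [exact hdD|]. isplit; [exact hi|]. iexists x. exact h.
Qed.

Lemma two_injective : (forall G, G ⊢ FiniteSetsInjective) -> forall G, G ⊢ TwoInjective.
Proof.
  intros H G. iintro t. iintro ht. iex (nat_ex G) as N HN.
  pose proof (two_in_nat _ _ _ HN ht) as htN.
  iall (H G) N as h. pose proof (prf_ImpE _ _ _ _ h HN) as h1; simp_form_in h1.
  iallin h1 htN as h2.
  assert (h3 : G ⊢ TwoLe t).
  { iexists t. isplit; [exact ht|]. iright; apply prf_EqI. }
  pose proof (prf_ImpE _ _ _ _ h2 h3) as h4. iall h4 t as h5.
  apply (prf_ImpE _ _ _ _ h5).
  (* The identity exhibits 2 as a set of cardinality 2. *)
  imapfrom (1 ≐ 0) t t as f hf hr.
  { intros x; iintro hx. iexists x. isplit; [exact hx | apply prf_EqI]. }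
  { intros x y y'. iintro hx. iintro hy. iintro hy'. iintro k. iintro k'.
    apply eq_trans with x; [apply eq_sym; exact k | exact k']. }
  iexists f. isplit; [exact hf|]. iintroin y hy. apply exu_intro with y.
  - simp_form. ibwd (hr y y). isplit; [exact hy|]. isplit; [exact hy | apply prf_EqI].
  - step; intros x k; simp_form_in k. ifwd (hr x y) k as l.
    iand l as [_ l]. iand l as [_ l]. exact l.
Qed.

(** Gives (4) from (1) and from (2) alike. Two distinct points make the pair discrete, since
    membership in a pair is a disjunction. *)
Lemma pair_discrete_injective G x y z :
  G ⊢ IsPair x y z -> G ⊢ ¬ x ≐ y -> G ⊢ IsInjective z -> G ⊢ DiscreteInjectiveExists.
Proof.
  intros hz hne hi. iexists z. isplit; [|isplit; [exact hi|]].
  - iintroin u hu. iintroin v hv.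
    ior (iff_fwd _ _ _ (pair_mem _ _ _ _ u hz) hu) as k;
      ior (iff_fwd _ _ _ (pair_mem _ _ _ _ v hz) hv) as l.
    + ileft. apply eq_trans with x; [exact k | apply eq_sym; exact l].
    + iright. irewrite -> k. irewrite -> l. exact hne.
    + iright. irewrite -> k. irewrite -> l. iintro m. apply (prf_ImpE _ _ _ _ hne). apply eq_sym; exact m.
    + ileft. apply eq_trans with y; [exact k | apply eq_sym; exact l].
  - apply exin_intro with x; [exact (pair_mem_l _ _ _ _ hz)|].
    simp_form. apply exin_intro with y; [exact (pair_mem_r _ _ _ _ hz)|]. exact hne.
Qed.

Lemma discrete_of_two : (forall G, G ⊢ TwoInjective) -> forall G, G ⊢ DiscreteInjectiveExists.
Proof.
  intros H G. iex (two_ex G) as t ht. iex (empty_ex G) as o ho. iex (one_ex G) as i hi.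
  apply pair_discrete_injective with o i t.
  - exact (iff_fwd _ _ _ (two_pair _ _ _ _ ho hi) ht).
  - exact (empty_ne_one _ _ _ ho hi).
  - iall (H G) t as h. exact (prf_ImpE _ _ _ _ h ht).
Qed.

Lemma discrete_of_disjoint_unions :
  (forall G, G ⊢ DisjointUnionsInjective) -> forall G, G ⊢ DiscreteInjectiveExists.
Proof.
  intros H G. iex (two_ex G) as t ht. iex (empty_ex G) as o ho. iex (one_ex G) as i hi.
  iex (nat_ex G) as N HN. pose proof (two_in_nat _ _ _ HN ht) as htN.
  (* The family is constant with value 1 on the index set 2, so its codomain is {1} and its disjoint
     union is {⟨0, 0⟩, ⟨1, 0⟩}. *)
  iex (pair_ex G i i) as C hC. iex (opair_ex G o o) as d hd. iex (opair_ex G i o) as d' hd'.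
  iex (pair_ex G d d') as D hD.
  assert (Ci : forall s, G ⊢ s ∈ C ⟶ s ≐ i).
  { intros s; iintro h. ior (iff_fwd _ _ _ (pair_mem _ _ _ _ s hC) h) as k; exact k. }
  assert (oi : G ⊢ o ∈ i) by (ibwd (one_mem _ _ o hi); exact ho).
  assert (ot : G ⊢ o ∈ t) by (ibwd (two_mem _ _ o ht); ileft; exact ho).
  assert (it : G ⊢ i ∈ t) by (ibwd (two_mem _ _ i ht); iright; exact hi).
  imapfrom (0 ≐ 0) t C as F hF hr.
  { intros x; iintro hx. iexists i. isplit; [exact (pair_mem_l _ _ _ _ hC) | apply prf_EqI]. }
  { intros x y y'. iintro hx. iintro hy. iintro hy'. iintro e. iintro e'.
    apply eq_trans with i; [|apply eq_sym]; apply (prf_ImpE _ _ _ _ (Ci _)); assumption. }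
  assert (Fi : forall x, G ⊢ x ∈ t ⟶ Rel F x i).
  { intros x; iintro hx. ibwd (hr x i). isplit; [exact hx|].
    isplit; [exact (pair_mem_l _ _ _ _ hC) | apply prf_EqI]. }
  apply pair_discrete_injective with d d' D; [exact hD| |].
  { iintro e. apply (prf_ImpE _ _ _ _ (empty_ne_one _ _ _ ho hi)).
    apply opair_inj_l with o o d'; [|exact hd']. irewrite <- e; exact hd. }
  iall (H G) N as h. pose proof (prf_ImpE _ _ _ _ h HN) as h1; simp_form_in h1.
  iallin h1 htN as h2.
  assert (h3 : G ⊢ TwoLe t).
  { iexists t. isplit; [exact ht|]. iright; apply prf_EqI. }
  pose proof (prf_ImpE _ _ _ _ h2 h3) as h4. iall h4 C as h5. iall h5 F as h6.
  pose proof (prf_ImpE _ _ _ _ h6 hF) as h7.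
  clear h h1 h2 h4 h5 h6.
  assert (h8 : G ⊢ AllIn t (All (Rel (2 + F) 1 0 ⟶ IsInjective 0))).
  { iintroin j hj. iintro s. iintro hs.
    pose proof (prf_ImpE _ _ _ _ (Ci s) (map_cod _ _ _ _ _ _ hF hs)) as e.
    irewrite -> e. apply injective_singleton with o; [exact oi|].
    intros x; iintro hx. apply empty_eq; [|exact ho].
    exact (iff_fwd _ _ _ (one_mem _ _ x hi) hx). }
  pose proof (prf_ImpE _ _ _ _ h7 h8) as h9. iall h9 D as h10.
  apply (prf_ImpE _ _ _ _ h10). clear h7 h9 h10.
  iintro z. iiff k.
  - ior (iff_fwd _ _ _ (pair_mem _ _ _ _ z hD) k) as e.
    + apply exin_intro with o; [exact ot|]. simp_form. iexists i. iexists o.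
      isplit; [exact (prf_ImpE _ _ _ _ (Fi o) ot)|]. isplit; [exact oi|]. irewrite -> e; exact hd.
    + apply exin_intro with i; [exact it|]. simp_form. iexists i. iexists o.
      isplit; [exact (prf_ImpE _ _ _ _ (Fi i) it)|]. isplit; [exact oi|]. irewrite -> e; exact hd'.
  - iexin k as j hj k. iex k as s k. iex k as x k. iand k as [hs k]. iand k as [hx k].
    pose proof (prf_ImpE _ _ _ _ (Ci s) (map_cod _ _ _ _ _ _ hF hs)) as e.
    pose proof (mem_eq_r _ _ _ _ e hx) as hx'. ifwd (one_mem _ _ x hi) hx' as hx0.
    pose proof (empty_eq _ _ _ ho hx0) as ex. ibwd (pair_mem _ _ _ _ z hD).
    ior (iff_fwd _ _ _ (two_mem _ _ j ht) hj) as l.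
    + ileft. apply opair_eq with j x; [exact k|]. irewrite <- ex.
      irewrite <- (empty_eq _ _ _ ho l). exact hd.
    + iright. apply opair_eq with j x; [exact k|]. irewrite <- ex.
      irewrite <- (one_eq _ _ _ hi l). exact hd'.
Qed.

(** Treating [o ∈ p] in place of a general formula keeps the formulas defining X and [f] atomic in
    the parameters; the set {o} stands for 1. *)
Lemma wem_of_discrete_mem G o p :
  G ⊢ DiscreteInjectiveExists -> G ⊢ ¬ o ∈ p ⋎ ¬ ¬ o ∈ p.
Proof.
  intros h. iex h as E h. iand h as [hd h]. iand h as [hi h].
  iexin h as x0 h0 h. iexin h as x1 h1 hne.
  iex (pair_ex G o o) as Y hY.
  isep (S o ∈ S p ⋎ ¬ S o ∈ S p) Y as X hX.
  assert (HS : G ⊢ Subset X Y).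
  { iintroin z hz. ifwd (hX z) hz as k. iand k as [k _]; exact k. }
  imapfrom ((2 + o ∈ 2 + p ⋏ 0 ≐ 2 + x1) ⋎ (¬ 2 + o ∈ 2 + p ⋏ 0 ≐ 2 + x0)) X E
    as f hf hr.
  { intros x; iintro hx. ifwd (hX x) hx as k. iand k as [_ k]. ior k as k.
    - iexists x1. isplit; [exact h1|]. ileft. isplit; [exact k | apply prf_EqI].
    - iexists x0. isplit; [exact h0|]. iright. isplit; [exact k | apply prf_EqI]. }
  { intros x y y'. iintro hx. iintro hy. iintro hy'. iintro k. iintro k'.
    unfold subst1 in *; simp_form_in k; simp_form_in k'.
    ior k as k; ior k' as k'; iand k as [kp k]; iand k' as [kp' k'].
    - apply eq_trans with x1; [exact k | apply eq_sym; exact k'].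
    - iabsurd; exact (prf_ImpE _ _ _ _ kp' kp).
    - iabsurd; exact (prf_ImpE _ _ _ _ kp kp').
    - apply eq_trans with x0; [exact k | apply eq_sym; exact k']. }
  apply (injective_extend _ _ _ _ _ _ hi HS hf); step; intros g hg e.
  pose proof (pair_mem_l _ _ _ _ hY) as oY.
  iex (map_val _ _ _ _ _ hg oY) as v hv. pose proof (map_cod _ _ _ _ _ _ hg hv) as hvE.
  iallin hd hvE as k. iallin k h1 as l. ior l as l.
  - iright. iintro m. apply (prf_ImpE _ _ _ _ hne).
    apply eq_trans with v; [|exact l].
    apply (map_fun _ _ _ _ o _ _ hg); [|exact hv].
    apply (prf_ImpE _ _ _ _ (e o x0)). ibwd (hr o x0).
    isplit; [|isplit; [exact h0|]].
    + ibwd (hX o). isplit; [exact oY | iright; exact m].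
    + iright. isplit; [exact m | apply prf_EqI].
  - ileft. iintro m. apply (prf_ImpE _ _ _ _ l).
    apply (map_fun _ _ _ _ o _ _ hg hv).
    apply (prf_ImpE _ _ _ _ (e o x1)). ibwd (hr o x1).
    isplit; [|isplit; [exact h1|]].
    + ibwd (hX o). isplit; [exact oY | ileft; exact m].
    + ileft. isplit; [exact m | apply prf_EqI].
Qed.

Lemma wem_of_discrete A G :
  G ⊢ DiscreteInjectiveExists -> restricted A -> G ⊢ ¬ A ⋎ ¬ ¬ A.
Proof.
  intros h HA. iex (empty_ex G) as o ho. iex (pair_ex G o o) as Y hY.
  (* The truth value of [A] as a subset of 1; the shift reflects that [A] does not mention the
     separated element. *)
  apply (separation (ren S A) Y).
  { apply delta0_restricted, restricted_ren, HA. }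
  step; intros p hp.
  assert (E : G ⊢ o ∈ p ⟷ A).
  { pose proof (hp o) as k. unfold subst0 in k.
    rewrite ren_ren, ren_id in k by reflexivity.
    iiff l.
    - ifwd k l as m; iand m as [_ m]; exact m.
    - apply (iff_bwd _ _ _ k). isplit; [exact (pair_mem_l _ _ _ _ hY) | exact l]. }
  ior (wem_of_discrete_mem _ o p h) as k.
  - ileft; iintro l. apply (prf_ImpE _ _ _ _ k). exact (iff_bwd _ _ _ E l).
  - iright; iintro l. apply (prf_ImpE _ _ _ _ k). iintro m.
    apply (prf_ImpE _ _ _ _ l). exact (iff_fwd _ _ _ E m).
Qed.

(** Weak excluded middle is invariant under provable equivalence. This passes from the schema for
    literally restricted formulas to conditions built from [Rel], as in the union step. *)
Lemma wem_delta0 :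
  (forall A, RWEM A -> T A) -> forall A G, delta0 A -> G ⊢ ¬ A ⋎ ¬ ¬ A.
Proof.
  intros H A G (B & RB & E).
  assert (w : G ⊢ ¬ B ⋎ ¬ ¬ B) by (apply prf_Ax, H; now constructor).
  ior w as w.
  - ileft; iintro h. exact (prf_ImpE _ _ _ _ w (iff_fwd _ _ _ (E _) h)).
  - iright; iintro h. apply (prf_ImpE _ _ _ _ w); iintro k.
    exact (prf_ImpE _ _ _ _ h (iff_bwd _ _ _ (E _) k)).
Qed.

End Logic.

(** * The four equivalences *)

Lemma theory_sentence X : (forall r, ren r X = X) -> theory (extend CZF0 (eq X)).
Proof. intros HX; apply theory_extend; intros r A <-; symmetry; apply HX. Qed.

(** The two implications are assumed over all theories because they are used over different ones:
    the first over [CZF0] with [X], the second over [CZF0] with RWEM. *)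
Lemma equivalent_RWEM X :
  (forall r, ren r X = X) ->
  (forall T, theory T -> (forall G, prf T G X) ->
    forall G, prf T G DiscreteInjectiveExists) ->
  (forall T, theory T -> (forall A G, delta0 (T := T) A -> prf T G (¬ A ⋎ ¬ ¬ A)) ->
    forall G, prf T G X) ->
  equivalent_over CZF0 (eq X) RWEM.
Proof.
  intros HX Hdisc Hwem; split.
  - intros A [B HB].
    pose proof (theory_sentence X HX) as HT.
    apply (wem_of_discrete HT); [|exact HB].
    apply (Hdisc _ HT); intros G; apply prf_Ax; now right.
  - intros A <-.
    assert (HT : theory (extend CZF0 RWEM)) by (apply theory_extend, RWEM_ren).
    apply (Hwem _ HT), wem_delta0; intros A HA; now right.
Qed.

Theorem theorem8 :
  equivalent_over CZF0 (eq TwoInjective) RWEM /\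
  equivalent_over CZF0 (eq DisjointUnionsInjective) RWEM /\
  equivalent_over CZF0 (eq FiniteSetsInjective) RWEM /\
  equivalent_over CZF0 (eq DiscreteInjectiveExists) RWEM.
Proof.
  split; [|split; [|split]]; apply equivalent_RWEM; try reflexivity;
    intros T HT H.
  - exact (discrete_of_two HT H).
  - exact (two_injective HT (finite_sets_injective HT H)).
  - exact (discrete_of_disjoint_unions HT H).
  - exact (disjoint_unions_injective HT H).
  - exact (discrete_of_two HT (two_injective HT H)).
  - exact (finite_sets_injective HT H).
  - exact H.
  - exact (discrete_of_two HT (two_injective HT (finite_sets_injective HT H))).
Qed.
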